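(* Let $\mathscr C$ be an extension closed variety of finite groups, and let $H$ be an open subgroup of the free pro-$\mathscr C$ product $\Gamma=\coprod_{\alpha\in A}\Gamma_\alpha$ of pro-$\mathscr C$ groups $\Gamma_\alpha$ indexed by a set $A$. Then, for each $\alpha\in A$, there exists a set $D_\alpha$ of representatives of the double cosets $H\backslash\Gamma/\Gamma_\alpha$ such that the family of inclusions $$\{\,u\Gamma_\alpha u^{-1}\cap H\hookrightarrow H\mid u\in D_\alpha,\ \alpha\in A\,\}$$ converges, and $H$ is the free pro-$\mathscr C$ product $$H=\Big[\coprod_{\alpha\in A,\,u\in D_\alpha}u\Gamma_\alpha u^{-1}\cap H\Big]\amalg\Phi,$$ where $\Phi$ is a free pro-$\mathscr C$ group of finite rank.
   Context: A variety of finite groups is a nonempty class $\mathscr C$ of finite groups closed under taking subgroups, finite direct products and homomorphic images; it is extension closed if it is moreover closed under extensions of groups. A pro-$\mathscr C$ group is an inverse limit of groups in $\mathscr C$. Let $\Gamma$ and $\Gamma_\alpha$ ($\alpha\in A$) be pro-$\mathscr C$ groups and $\iota_\alpha\colon\Gamma_\alpha\to\Gamma$ continuous homomorphisms. The family $\{\iota_\alpha\mid\alpha\in A\}$ is convergent (converges) if every open neighborhood $U$ of $1$ in $\Gamma$ contains all but a finite number of the images $\iota_\alpha(\Gamma_\alpha)$. $\Gamma$ together with the convergent family of the $\iota_\alpha$ is the free pro-$\mathscr C$ product of the $\Gamma_\alpha$, written $\Gamma=\coprod_{\alpha\in A}\Gamma_\alpha$, if for every pro-$\mathscr C$ group $K$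 and every convergent family of continuous homomorphisms $\lambda_\alpha\colon\Gamma_\alpha\to K$ ($\alpha\in A$) there is a unique continuous homomorphism $\lambda\colon\Gamma\to K$ with $\lambda\iota_\alpha=\lambda_\alpha$ for all $\alpha$. The maps $\iota_\alpha$ are injective, and $\Gamma_\alpha$ is identified with its image in $\Gamma$. The symbol $\amalg$ denotes the free pro-$\mathscr C$ product of two groups. In the decomposition of $H$, the factors are subgroups of $H$, indexed by the pairs $(\alpha,u)$ with $\alpha\in A$, $u\in D_\alpha$, together with $\Phi$, and the structure maps are the inclusions. A free pro-$\mathscr C$ group of finite rank is a free pro-$\mathscr C$ group on a finite (discrete) set. *)

(* Defs.v *)
From HB Require Import structures.
From mathcomp Require Import all_boot all_order all_fingroup.
From mathcomp Require Import all_classical topology.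

Set Implicit Arguments.
Unset Strict Implicit.
Unset Printing Implicit Defensive.

Local Open Scope classical_set_scope.
Local Open Scope group_scope.

(* A class of finite groups is a predicate on the subgroups of all finGroupTypes,
   so that it applies at once to subgroups, quotients and morphic images. *)
Definition group_class := forall gT : finGroupType, {group gT} -> Prop.

(* Closure under nonempty finite products reduces to the binary case; the empty
   product is the trivial group, a homomorphic image of any member of [C]. *)
Record variety (C : group_class) : Prop := Variety {
  variety_nonempty : exists (gT : finGroupType) (G : {group gT}), C gT G;
  variety_subgroup : forall (gT : finGroupType) (G H : {group gT}),
    H \subset G -> C gT G -> C gT H;
  variety_product : forall (gT hT : finGroupType) (G : {group gT})
    (H : {group hT}), C gT G -> C hT H -> C (gT * hT)%type (setX_group G H);
  variety_image : forall (gT hT : finGroupType) (G : {group gT})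
    (f : {morphism G >-> hT}), C gT G -> C hT (f @* G)%G
}.

Record extension_closed_variety (C : group_class) : Prop :=
    ExtensionClosedVariety {
  extension_closed_isVariety :> variety C;
  variety_extension : forall (gT : finGroupType) (G N : {group gT}),
    N <| G -> C gT N -> C (coset_of N) (G / N)%G -> C gT G
}.

(* [monoid.Group] is the class of [groupType]; the short name is shadowed by
   fingroup. *)
HB.mixin Record isTopGroup G & monoid.Group G & Topological G := {
  mulg_continuous : continuous (fun xy : G * G => xy.1 * xy.2);
  invg_continuous : continuous (fun x : G => x^-1)
}.

#[short(type="topGroupType")]
HB.structure Definition TopGroup :=
  {G of isTopGroup G & monoid.Group G & Topological G}.

#[short(type="contHom")]
HB.structure Definition ContHom (G K : topGroupType) :=
  {f of @isMultiplicative G K f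
      & @Multiplicative_isUMagmaMorphism G K f
      & @isContinuous G K f}.

Record subgroup (G : groupType) := Subgroup {
  subgroup_set :> set G;
  subgroup1 : subgroup_set 1;
  subgroupM : forall x y,
    subgroup_set x -> subgroup_set y -> subgroup_set (x * y);
  subgroupV : forall x, subgroup_set x -> subgroup_set x^-1
}.

Section SubgroupTopGroup.
Variables (G : topGroupType) (S : subgroup G).

Fact subgroup_group_closed : group_closed (fun x : G => x \in (S : set G)).
Proof.
split; first by apply/mem_set; exact: subgroup1.
move=> x y /set_mem Sx /set_mem Sy; apply/mem_set.
by apply: subgroupM => //; exact: subgroupV.
Qed.

(* The topology of [set_type S] is the library's subspace topology. *)

HB.instance Definition _ :=
  SubType.copy (set_type S) {x : G | x \in (S : set G)}.
HB.instance Definition _ :=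
  SubChoice_isSubGroup.Build G (fun x => x \in (S : set G)) (set_type S)
    subgroup_group_closed.

Definition subgroup_val : set_type S -> G := \val.

Fact subgroup_val_continuous : continuous subgroup_val.
Proof. exact: initial_continuous. Qed.

Fact subgroup_mul_continuous :
  continuous (fun xy : set_type S * set_type S => xy.1 * xy.2).
Proof.
apply: (@continuous_comp_initial _ _ _ (\val : set_type S -> G)).
have -> : \val \o (fun xy : set_type S * set_type S => xy.1 * xy.2) =
  (fun xy : G * G => xy.1 * xy.2) \o
  (fun xy : set_type S * set_type S => (subgroup_val xy.1, subgroup_val xy.2)).
  by [].
move=> xy; apply: continuous_comp; last exact: mulg_continuous.
have c1 : subgroup_val p.1 @[p --> xy] --> subgroup_val xy.1.
  by apply: continuous_comp; [exact: cvg_fst | exact: subgroup_val_continuous].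
have c2 : subgroup_val p.2 @[p --> xy] --> subgroup_val xy.2.
  by apply: continuous_comp; [exact: cvg_snd | exact: subgroup_val_continuous].
exact: cvg_pair c1 c2.
Qed.

Fact subgroup_inv_continuous : continuous (fun x : set_type S => x^-1).
Proof.
apply: (@continuous_comp_initial _ _ _ (\val : set_type S -> G)).
have -> : \val \o (fun x : set_type S => x^-1) =
  (fun x : G => x^-1) \o subgroup_val.
  by [].
move=> x; apply: continuous_comp; first exact: subgroup_val_continuous.
exact: invg_continuous.
Qed.

HB.instance Definition _ := isTopGroup.Build (set_type S)
  subgroup_mul_continuous subgroup_inv_continuous.

Fact subgroup_val_morphism : monoid_morphism subgroup_val.
Proof. by []. Qed.

HB.instance Definition _ := isUMagmaMorphism.Build (set_type S) G subgroup_val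
  subgroup_val_morphism.
HB.instance Definition _ :=
  isContinuous.Build (set_type S) G subgroup_val subgroup_val_continuous.

Definition incl_hom : contHom (set_type S) G := subgroup_val.

End SubgroupTopGroup.

Section HomRange.
Variables (G K : topGroupType) (f : contHom G K).

Fact hom_range1 : range f 1.
Proof. by exists 1 => //; rewrite gmulf1. Qed.

Fact hom_rangeM x y : range f x -> range f y -> range f (x * y).
Proof. by move=> [a _ <-] [b _ <-]; exists (a * b) => //; rewrite gmulfM. Qed.

Fact hom_rangeV x : range f x -> range f x^-1.
Proof. by move=> [a _ <-]; exists a^-1 => //; rewrite gmulfV. Qed.

Definition hom_range : subgroup K :=
  Subgroup hom_range1 hom_rangeM hom_rangeV.

End HomRange.

Section ConjCap.
Variables (G : topGroupType) (H S : subgroup G) (u : G).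

(* u S u^-1 :&: H, as a subset of the group H *)
Definition conj_cap_set : set H :=
  [set h | exists2 s, (S : set G) s & incl_hom H h = u * s * u^-1].

Fact conj_cap1 : conj_cap_set 1.
Proof. by exists 1; [exact: subgroup1 | rewrite gmulf1 mulg1 mulgV]. Qed.

Fact conj_capM x y : conj_cap_set x -> conj_cap_set y -> conj_cap_set (x * y).
Proof.
move=> [s Ss xE] [t St yE]; exists (s * t); first exact: subgroupM.
by rewrite gmulfM /= xE yE !mulgA mulgVK.
Qed.

Fact conj_capV x : conj_cap_set x -> conj_cap_set x^-1.
Proof.
move=> [s Ss xE]; exists s^-1; first exact: subgroupV.
by rewrite gmulfV /= xE !invgM invgK mulgA.
Qed.

Definition conj_cap : subgroup H := Subgroup conj_cap1 conj_capM conj_capV.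

End ConjCap.

Definition double_coset (G : groupType) (H S : set G) (u : G) : set G :=
  [set g | exists2 h, H h & exists2 s, S s & g = h * u * s].

Definition double_coset_reps (G : groupType) (H S D : set G) : Prop :=
  forall g, exists! u, D u /\ double_coset H S g u.

Record inverse_system := InverseSystem {
  isys_disp : Order.disp_t;
  isys_index : porderType isys_disp;
  isys_obj : isys_index -> finGroupType;
  isys_map : forall i j, (i <= j)%O ->
    {multiplicative isys_obj j -> isys_obj i};
  isys_inhabited : inhabited isys_index;
  isys_directed : forall i j : isys_index, exists k, (i <= k)%O /\ (j <= k)%O;
  isys_map_id : forall i (le_ii : (i <= i)%O) x, isys_map le_ii x = x;
  isys_map_comp : forall i j k (le_ij : (i <= j)%O) (le_jk : (j <= k)%O)
    (le_ik : (i <= k)%O) x,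
    isys_map le_ij (isys_map le_jk x) = isys_map le_ik x
}.

Definition isys_product (X : inverse_system) :=
  prod_topology (fun i : isys_index X => discrete_topology (isys_obj i)).

Definition isys_limit (X : inverse_system) : set (isys_product X) :=
  [set x | forall i j (le_ij : (i <= j)%O), isys_map le_ij (x j) = x i].
Arguments isys_limit : clear implicits.

(* [G] is isomorphic, as a topological group, to the subgroup [isys_limit X] of
   the product with its subspace topology. *)
Definition is_inverse_limit (X : inverse_system) (G : topGroupType) : Prop :=
  exists f : G -> isys_product X,
    [/\ forall i, {morph (fun g => f g i : isys_obj i) : x y / x * y},
        injective f,
        range f = isys_limit X
      & forall U : set G, open U <-> exists2 V, open V & U = f @^-1` V].

Definition pro (C : group_class) (G : topGroupType) : Prop :=
  exists2 X : inverse_system,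
    forall i : isys_index X, C (isys_obj i) [set: isys_obj i]%G
    & is_inverse_limit X G.

(* "All but finitely many" refers to the indices of the family. *)
Definition convergent (I : Type) (G : topGroupType) (X : I -> topGroupType)
    (f : forall i, contHom (X i) G) : Prop :=
  forall U : set G, open_nbhs (1 : G) U ->
    finite_set [set i | ~ (range (f i) `<=` U)].

Record free_product (C : group_class) (I : Type) (G : topGroupType)
    (X : I -> topGroupType) (iota : forall i, contHom (X i) G) : Prop :=
    FreeProduct {
  free_product_pro : pro C G;
  free_product_pro_factor : forall i, pro C (X i);
  free_product_convergent : convergent iota;
  free_product_universal : forall (K : topGroupType)
    (lam_ : forall i, contHom (X i) K),
    pro C K -> convergent lam_ ->
    exists2 lam : contHom G K,
      forall i, lam \o iota i =1 lam_ i
      & forall mu : contHom G K, (forall i, mu \o iota i =1 lam_ i) -> mu =1 lam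
}.

(* [F] is free pro-[C] on a finite discrete space, on which every map is
   continuous. *)
Definition free_pro_finite_rank (C : group_class) (F : topGroupType) : Prop :=
  pro C F /\
  exists (X : finType) (e : X -> F),
    forall (K : topGroupType) (phi : X -> K), pro C K ->
    exists2 lam : contHom F K,
      lam \o e =1 phi
      & forall mu : contHom F K, mu \o e =1 phi -> mu =1 lam.

Section Decomposition.
Variables (A : Type) (G : topGroupType) (S : A -> subgroup G) (H : subgroup G).
Variable D : A -> set G.

Definition conj_cap_family (au : {a : A & set_type (D a)}) : subgroup H :=
  conj_cap H (S (tag au)) (\val (tagged au)).

(* [None] is the index of the extra factor. *)
Definition decomposition (Phi : subgroup H)
    (i : option {a : A & set_type (D a)}) : subgroup H :=
  if i is Some au then conj_cap_family au else Phi.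

End Decomposition.

(* Main.v *)
Require Import Defs.
From HB Require Import structures.
From mathcomp Require Import all_boot all_order all_fingroup.
From mathcomp Require Import finmap.
From mathcomp Require Import all_classical topology.

(** The proof reads the universal property of the free product [G] through
    cocycles on the finite space S of right cosets of [H], with root [s0].

    A continuous homomorphism from [H] to a pro-C group [K] amounts to a
    continuous cocycle c(s, gh) = c(s, g) c(s.g, h) on [G] with values in [K]:
    restricting c to the root and its stabilizer [H] gives the homomorphism, and
    coset representatives t(s) recover the cocycle as the value of the
    homomorphism at t(s) g t(s.g)^-1. A cocycle is in turn a homomorphism from
    [G] to the wreath product of [K] with a finite quotient of [G] acting on S.
    Since C is closed under extensions this wreath product is pro-C
    ([wreath_pro]), so the universal property of [G] applies to it: cocycles on
    [G] are the convergent families of cocycles on the factors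
    ([cocycle_extension]).

    On a single factor a cocycle is easy to prescribe. It splits along the
    orbits of the factor on S, which are the double cosets. On the orbit with
    base point of representative u it consists of a homomorphism on the
    stabilizer, that is on the intersection of [H] with the conjugate of the
    factor by u, and of one arbitrary value for each other point of the orbit.
    Those arbitrary values are the values of the homomorphism at the Schreier
    generators [cross]. If the coset representatives are chosen along a spanning
    tree of S whose edges run inside orbits ([kurosh_system]), the generators of
    the tree edges are trivial, and the remaining ones form a basis of the free
    factor. There are finitely many, because almost all factors lie in the core
    of [H] and have only one-point orbits. This gives the existence half of the
    universal property ([extension_exists]).

    Uniqueness, the connectedness needed for the tree, and the identification
    of the cocycle with the given action all come from one fact: a closed
    subgroup of [G] containing the images of the factors is everything, because
    [G] retracts onto it ([free_product_generated], [subgroup_generated]).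

    That the various groups are pro-C is checked on an intrinsic
    characterization, compact Hausdorff groups with enough finite quotients in
    C ([pro_residually], [residually_pro]). *)

Set Implicit Arguments.
Unset Strict Implicit.
Unset Printing Implicit Defensive.

Local Open Scope classical_set_scope.
Local Open Scope group_scope.

(** * Topological groups and their finite quotients *)

Lemma continuousM (T : topologicalType) (G : topGroupType) (f g : T -> G) :
  continuous f -> continuous g -> continuous (fun x => f x * g x).
Proof.
move=> cf cg x.
exact: (continuous2_cvg _ (f := f) (g := g) (h := fun a b : G => a * b)
  (mulg_continuous (f x, g x)) (cf x) (cg x)).
Qed.

Lemma continuousV (T : topologicalType) (G : topGroupType) (f : T -> G) :
  continuous f -> continuous (fun x => (f x)^-1).
Proof. by move=> cf x; apply: continuous_comp (cf x) (invg_continuous _). Qed.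

Lemma continuousJ (T : topologicalType) (G : topGroupType) (f : T -> G) a b :
  continuous f -> continuous (fun x => a * f x * b).
Proof.
move=> cf; apply: continuousM; last by move=> x; exact: cst_continuous.
by apply: continuousM => // x; exact: cst_continuous.
Qed.

Lemma continuous_mull (G : topGroupType) (a : G) : continuous (fun x => a * x).
Proof.
by apply: (@continuousM _ _ (fun=> a) id) => x; [exact: cst_continuous | exact: cvg_id].
Qed.

(** A continuous homomorphism to a finite discrete group. Surjectivity is left
    out: a class closed under subgroups also contains the image, and restrictions
    to subgroups stay of this form. *)
Record finite_quotient (C : group_class) (G : topGroupType) (Q : finGroupType)
    (f : G -> Q) : Prop := FiniteQuotient {
  finquo_class : C Q [set: Q]%G;
  finquoM : {morph f : x y / x * y};
  finquo_open : forall q, open (f @^-1` [set q])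
}.

Section MorphFacts.
Variables (G Q : groupType) (f : G -> Q) (fM : {morph f : x y / x * y}).

Lemma morph_one : f 1 = 1.
Proof. by apply: (mulgI (f 1)); rewrite -fM !mulg1. Qed.

Lemma morph_inv x : f x^-1 = (f x)^-1.
Proof. by apply: (mulgI (f x)); rewrite -fM !mulgV morph_one. Qed.
End MorphFacts.

Lemma subsetT_class (C : group_class) (gT : finGroupType) (G : {group gT}) :
  variety C -> C gT G -> C (subg_of G) [set: subg_of G]%G.
Proof.
move=> varC CG; have := variety_image varC (subg G) CG.
by congr (C _ _); apply/val_inj; rewrite /= im_subg.
Qed.

(** The corestriction to the image, stated through the fibres so that the kernel
    is visibly unchanged. *)
Lemma finite_quotient_onto (C : group_class) (G : topGroupType)
    (Q : finGroupType) (f : G -> Q) :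
  variety C -> finite_quotient C f ->
  exists (R : finGroupType) (g : G -> R),
    [/\ finite_quotient C g, range g = setT & forall x y, g x = g y <-> f x = f y].
Proof.
move=> varC [CQ fM fO].
have gS : group_set [set q : Q | `[< range f q >]].
  apply/group_setP; split=> [|x y].
    by rewrite finset.inE; apply/asboolP; exists 1 => //; exact: morph_one.
  rewrite !finset.inE => /asboolP fx /asboolP fy; apply/asboolP.
  by move: fx fy => [a _ <-] [b _ <-]; exists (a * b) => //; rewrite fM.
pose S := Group gS.
have fS x : f x \in S by rewrite finset.inE; apply/asboolP; exists x.
pose g x := Subg (fS x); exists (subg_of S), g.
have gE x y : g x = g y <-> f x = f y.
  by split=> [/(congr1 val)//|fxy]; apply/val_inj.
split=> //; last first.
  apply/seteqP; split=> // -[q qS] _; have := qS.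
  by rewrite finset.inE => /asboolP fq; move: fq => [x _ xq]; exists x => //; apply/val_inj.
split.
- by apply: subsetT_class => //; apply: (variety_subgroup varC) CQ; exact: finset.subsetT.
- by move=> x y; apply/val_inj; rewrite /= fM.
move=> q; suff -> : g @^-1` [set q] = f @^-1` [set val q] by [].
apply/seteqP; split=> x /=; first by move=> <-.
by move=> fxq; apply/val_inj.
Qed.

(** * Intrinsic characterization of pro-C groups *)

(** The inverse-limit description of pro-C groups is awkward for closed
    subgroups and wreath products. This is the equivalent description used
    everywhere below: compact, Hausdorff, and separated at the identity by
    finite quotients in the class. *)
Record residually (C : group_class) (G : topGroupType) : Prop := Residually {
  residually_compact : compact [set: G];
  residually_hausdorff : hausdorff_space G;
  residually_quotient : forall U : set G, open_nbhs 1 U ->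
    exists (Q : finGroupType) (f : G -> Q),
      finite_quotient C f /\ forall g, f g = 1 -> U g
}.

Section ProResidually.
Variables (C : group_class) (G : topGroupType) (X : inverse_system).
Hypothesis (CX : forall i : isys_index X, @C (isys_obj i) [set: isys_obj i]%G).
Variable f : G -> isys_product X.
Hypothesis fM : forall i, {morph (fun g => f g i : isys_obj i) : x y / x * y}.
Hypothesis f_inj : injective f.
Hypothesis f_im : range f = isys_limit X.
Hypothesis f_open : forall U : set G, open U <-> exists2 V, open V & U = f @^-1` V.

Lemma coord_continuous i :
  continuous (fun x : isys_product X => x i : discrete_topology (isys_obj i)).
Proof. exact: proj_continuous. Qed.

Lemma fiber_open i q : open [set g | f g i = q].
Proof.
have /continuousP := coord_continuous (i := i).
move=> /(_ [set q] (discrete_open _)) oq.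
by apply/f_open; exists ((fun x : isys_product X => x i) @^-1` [set q]).
Qed.

Lemma limit_closed : closed (isys_limit X).
Proof.
have -> : isys_limit X = \bigcap_(i in [set: isys_index X])
    \bigcap_(j in [set: isys_index X]) \bigcap_(leij in [set: is_true (i <= j)%O])
      [set x : isys_product X | isys_map leij (x j) = x i].
  apply/seteqP; split=> [x xX i _ j _ leij _|x xX i j leij]; first exact: xX.
  exact: (xX i I j I leij I).
apply: closed_bigI => i _; apply: closed_bigI => j _; apply: closed_bigI => leij _.
have -> : [set x : isys_product X | isys_map leij (x j) = x i] =
    \bigcap_(q in [set: isys_obj j]) ((fun x : isys_product X => x j) @^-1` (~` [set q]) `|`
      (fun x : isys_product X => x i) @^-1` [set isys_map leij q]).
  apply/seteqP; split=> x /=.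
    by move=> xij q _; have [<-|] := pselect (x j = q); [right|left].
  by move=> /(_ (x j) I) [h|->] //; case: h.
apply: closed_bigI => q _; apply: closedU.
  by apply: closed_comp (discrete_closed _) => x _; exact: coord_continuous.
by apply: closed_comp (discrete_closed _) => x _; exact: coord_continuous.
Qed.

Lemma limit_compact : compact (isys_limit X).
Proof.
apply: (subclosed_compact limit_closed (B := setT)) => //.
have := @tychonoff (isys_index X)
  (fun i => discrete_topology (isys_obj i)) (fun=> setT).
move=> H; rewrite (_ : setT = [set x | forall i, setT (x i)]); last first.
  by apply/seteqP; split.
apply: H => i.
have := @finite_compact (discrete_topology (isys_obj i)) setT.
by apply; exact: finite_finset.
Qed.

Lemma pro_compact : compact [set: G].
Proof.
move=> F FF _.
have [y [yX yF]] : isys_limit X `&` cluster (f @ F) !=set0.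
  apply: limit_compact => //; rewrite /nbhs /=.
  by apply: filterS filterT => x _; rewrite -f_im; exists x.
move: yX; rewrite -f_im => -[x _ xy]; exists x; split=> // S B FS.
rewrite nbhsE => -[B' [oB' B'x] sB'].
have [V oV VB'] := (f_open B').1 oB'.
have [z [[w Sw <-] Vz]] : (f @` S) `&` V !=set0.
  apply: yF; last by apply: open_nbhs_nbhs; split=> //; rewrite -xy; move: B'x; rewrite VB'.
  by rewrite /nbhs /=; apply: filterS FS => u Su; exists u.
by exists w; split=> //; apply: sB'; rewrite VB'.
Qed.

Lemma pro_hausdorff : hausdorff_space G.
Proof.
move=> x y xy; apply: f_inj; apply: functional_extensionality_dep => i.
apply: contrapT => nxy.
have ox z : nbhs z [set g | f g i = f z i].
  by apply: open_nbhs_nbhs; split=> //; exact: fiber_open.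
have [z [/= zx zy]] := xy _ _ (ox x) (ox y).
by apply: nxy; rewrite -zx.
Qed.

Lemma pro_quotient i : finite_quotient C (fun g => f g i : isys_obj i).
Proof. by split; [exact: CX | exact: fM | move=> q; exact: fiber_open]. Qed.

Lemma coord_compat i j (leij : (i <= j)%O) g : isys_map leij (f g j) = f g i.
Proof.
have : isys_limit X (f g) by rewrite -f_im; exists g.
exact.
Qed.

(** Compactness replaces a description of the basic open sets of the product: if
    no coordinate kernel were inside [U], the kernels minus [U] would form a
    directed family of nonempty closed sets, and a common point would be a
    nontrivial element with all coordinates trivial. *)
Lemma pro_small (U : set G) : open_nbhs 1 U ->
  exists i, forall g, f g i = 1 -> U g.
Proof.
move=> [oU U1]; apply: contrapT => noi.
have ex i : exists g, f g i = 1 /\ ~ U g.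
  apply: contrapT => nog; apply: noi; exists i => g g1.
  by apply: contrapT => nUg; apply: nog; exists g.
pose B i := [set g | f g i = 1] `&` ~` U.
have Bfil : ProperFilter (filter_from [set: isys_index X] B).
  apply: filter_from_proper; last by move=> i _; have [g] := ex i; exists g.
  apply: filter_from_filter; first by have [i] := isys_inhabited X; exists i.
  move=> i j _ _; have [k [ik jk]] := isys_directed i j.
  exists k => // g [/= gk nUg]; split; split=> //=.
    by rewrite -(coord_compat ik) gk (morph_one (@gmulfM _ _ _)).
  by rewrite -(coord_compat jk) gk (morph_one (@gmulfM _ _ _)).
have [x [_ xB]] := pro_compact Bfil filterT.
have xi i : B i x.
  have cB : closed (B i).
    apply: closedI; last exact: open_closedC.
    rewrite -[X in closed X]setCK; apply: open_closedC.
    suff -> : ~` [set g | f g i = 1] =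
      \bigcup_(q in [set q | q <> 1]) [set g | f g i = q].
      by apply: bigcup_open => q _; exact: fiber_open.
    apply/seteqP; split=> g /=; first by move=> gn; exists (f g i).
    by move=> [q qn ->].
  by apply: cB => V xV; apply: xB xV; exists i.
have x1 : x = 1.
  apply: f_inj; apply: functional_extensionality_dep => i.
  by rewrite (xi i).1 (morph_one (@fM i)).
have [i] := isys_inhabited X.
by have := (xi i).2; rewrite x1.
Qed.

Lemma pro_embedded : residually C G.
Proof.
split; [exact: pro_compact | exact: pro_hausdorff |].
move=> U /pro_small [i Ui].
by exists (isys_obj i), (fun g => f g i); split=> //; exact: pro_quotient.
Qed.

End ProResidually.

Lemma pro_residually C G : pro C G -> residually C G.
Proof. by move=> [X CX [f [? ? ? ?]]]; exact: (@pro_embedded C G X CX f). Qed.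

(** The coordinatewise criterion for filters gives continuity of maps into a
    product and also, below, a base of neighbourhoods of 1 in a wreath
    product. *)
Lemma prod_cvg (I : Type) (K : I -> topologicalType)
    (F : set_system (prod_topology K)) (x : prod_topology K) :
  Filter F -> (forall i, (fun f : prod_topology K => f i) @ F --> x i) -> F --> x.
Proof.
move=> FF cF; apply/cvg_sup => i U [_ [[B oB <-] Bx] sB].
by apply: filterS sB _; apply: cF; apply: open_nbhs_nbhs.
Qed.

Lemma prod_continuous (T : topologicalType) (I : Type) (K : I -> topologicalType)
    (f : T -> prod_topology K) :
  (forall i, continuous (fun x => f x i)) -> continuous f.
Proof. by move=> cf x; apply: prod_cvg => i; exact: cf. Qed.

Section QuotientSystem.
Variables (C : group_class) (G : topGroupType).

(** The inverse system of a group satisfying [residually] is indexed by kernels,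
    ordered by reverse inclusion, and not by the quotient maps themselves: two
    maps with the same kernel would violate antisymmetry. One quotient is chosen
    for each kernel. *)
Definition quotient_kernel (N : set G) : Prop :=
  exists (Q : finGroupType) (f : G -> Q),
    [/\ finite_quotient C f, range f = setT & N = [set g | f g = 1]].

Definition kernel_index := {N : set G | `[< quotient_kernel N >]}.
HB.instance Definition _ := Choice.on kernel_index.

Definition kernel_le (M N : kernel_index) : bool := `[< val N `<=` val M >].

Fact kernel_le_refl : reflexive kernel_le.
Proof. by move=> N; apply/asboolP. Qed.

Fact kernel_le_anti : antisymmetric kernel_le.
Proof.
move=> M N /andP [/asboolP NM /asboolP MN].
by apply/val_inj/seteqP; split.
Qed.

Fact kernel_le_trans : transitive kernel_le.
Proof.
move=> M L N /asboolP ML /asboolP NM; apply/asboolP.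
exact: subset_trans NM ML.
Qed.

HB.instance Definition _ := Order.Le_isPOrder.Build set_display kernel_index
  kernel_le_refl kernel_le_anti kernel_le_trans.

Lemma kernel_leP (M N : kernel_index) : (M <= N)%O -> val N `<=` val M.
Proof. by move/asboolP. Qed.

Fact kernelP (N : kernel_index) : quotient_kernel (val N).
Proof. exact/asboolP/(valP N). Qed.

Definition kernel_obj (N : kernel_index) : finGroupType := projT1 (cid (kernelP N)).

Definition kernel_proj (N : kernel_index) : G -> kernel_obj N :=
  projT1 (cid (projT2 (cid (kernelP N)))).

Fact kernel_projP N : [/\ finite_quotient C (kernel_proj N),
  range (kernel_proj N) = setT & val N = [set g | kernel_proj N g = 1]].
Proof. exact: (projT2 (cid (projT2 (cid (kernelP N))))). Qed.

Lemma kernel_projM N : {morph kernel_proj N : x y / x * y}.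
Proof. by have [[]] := kernel_projP N. Qed.

(** The kernel alone decides which elements are identified, so the transition
    map induced by an inclusion of kernels does not depend on the chosen
    lifts. *)
Lemma kernel_proj_eq N x y :
  kernel_proj N x = kernel_proj N y <-> val N (x^-1 * y).
Proof.
have [_ _ ->] := kernel_projP N => /=.
rewrite kernel_projM (morph_inv (@kernel_projM N)); split=> [->|]; first exact: mulVg.
by move=> h; apply: esym; apply: (mulgI (kernel_proj N x)^-1); rewrite h mulVg.
Qed.

Fact kernel_lift_ex N (q : kernel_obj N) : exists g, kernel_proj N g = q.
Proof.
have [_ + _] := kernel_projP N => /seteqP [_ /(_ q I) [g _ <-]].
by exists g.
Qed.

Definition kernel_lift N (q : kernel_obj N) : G := projT1 (cid (kernel_lift_ex q)).

Lemma kernel_liftK N (q : kernel_obj N) : kernel_proj N (kernel_lift q) = q.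
Proof. exact: (projT2 (cid (kernel_lift_ex q))). Qed.

Definition kernel_map M N (leMN : (M <= N)%O) (q : kernel_obj N) : kernel_obj M :=
  kernel_proj M (kernel_lift q).

Lemma kernel_map_proj M N (leMN : (M <= N)%O) g :
  kernel_map leMN (kernel_proj N g) = kernel_proj M g.
Proof.
apply/kernel_proj_eq/(kernel_leP leMN)/kernel_proj_eq.
exact: kernel_liftK.
Qed.

Fact kernel_mapM M N (leMN : (M <= N)%O) : {morph kernel_map leMN : x y / x * y}.
Proof.
move=> x y; rewrite -(kernel_liftK x) -(kernel_liftK y) -kernel_projM.
by rewrite !kernel_map_proj kernel_projM.
Qed.

HB.instance Definition _ M N (leMN : (M <= N)%O) :=
  isMultiplicative.Build _ _ (kernel_map leMN) (kernel_mapM leMN).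

Hypothesis varC : variety C.
Hypothesis resG : residually C G.

Lemma small_kernel (U : set G) : open_nbhs 1 U ->
  exists N : kernel_index, val N `<=` U.
Proof.
move=> /(residually_quotient resG) [Q [f [qf fU]]].
have [R [g [qg gT gE]]] := finite_quotient_onto varC qf.
have kg : `[< quotient_kernel [set x | g x = 1] >].
  by apply/asboolP; exists R, g.
exists (exist (fun N => is_true `[< quotient_kernel N >]) _ kg) => x /= gx; apply: fU.
rewrite -(morph_one (finquoM qf)); apply/gE.
by rewrite gx (morph_one (finquoM qg)).
Qed.

Fact kernel_inhabited : inhabited kernel_index.
Proof. by have [|N _] := @small_kernel setT; [split=> //; exact: openT|]. Qed.

Fact kernel_directed (M N : kernel_index) : exists L, (M <= L)%O /\ (N <= L)%O.
Proof.
have [[CM fM fMo] _ ME] := kernel_projP M.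
have [[CN fN fNo] _ NE] := kernel_projP N.
have oMN : open_nbhs 1 (val M `&` val N).
  split; first by apply: openI; rewrite ?ME ?NE; [exact: fMo | exact: fNo].
  by rewrite ME NE /= (morph_one fM) (morph_one fN).
have [L LMN] := small_kernel oMN.
by exists L; split; apply/asboolP => x /LMN [].
Qed.

Fact kernel_map_id M (leMM : (M <= M)%O) x : kernel_map leMM x = x.
Proof. by rewrite /kernel_map kernel_liftK. Qed.

Fact kernel_map_comp L M N (leLM : (L <= M)%O) (leMN : (M <= N)%O)
  (leLN : (L <= N)%O) x : kernel_map leLM (kernel_map leMN x) = kernel_map leLN x.
Proof. by rewrite -(kernel_liftK x) !kernel_map_proj. Qed.

Definition kernel_system : inverse_system :=
  @InverseSystem _ kernel_index kernel_obj
    (fun M N leMN => kernel_map leMN : {multiplicative _ -> _})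
    kernel_inhabited kernel_directed kernel_map_id kernel_map_comp.

Lemma kernel_proj_open N q : open [set g | kernel_proj N g = q].
Proof. by have [[_ _ +] _ _] := kernel_projP N; apply. Qed.

Lemma kernel_proj_continuous N :
  continuous (kernel_proj N : G -> discrete_topology (kernel_obj N)).
Proof.
apply/continuousP => V _.
rewrite (_ : _ @^-1` V = \bigcup_(q in V) [set g | kernel_proj N g = q]).
  by apply: bigcup_open => q _; exact: kernel_proj_open.
by apply/seteqP; split=> g /=; [exists (kernel_proj N g) | move=> [q Vq ->]].
Qed.

(** The group embeds because the kernels shrink to 1. It fills the limit by
    compactness: the fibres over the coordinates of a compatible family are a
    directed family of nonempty closed sets. *)
Lemma kernel_limit : is_inverse_limit kernel_system G.
Proof.
pose f (g : G) : isys_product kernel_system := fun N => kernel_proj N g.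
exists f; split.
- by move=> N; exact: kernel_projM.
- move=> x y xy; apply: (residually_hausdorff resG) => U V Ux Vy.
  have [N NU] : exists N : kernel_index, forall g, val N g -> U (x * g).
    have [|N NU] := @small_kernel ((fun g => x * g) @^-1` (U°)); last first.
      by exists N => g /NU; exact: interior_subset.
    split; last by rewrite /= mulg1; exact: Ux.
    apply: open_comp (open_interior _) => g _.
    exact: continuous_mull.
  exists y; split; last exact: nbhs_singleton.
  rewrite -(mulVKg x y); apply: NU; apply/kernel_proj_eq.
  exact: (congr1 (fun z : isys_product kernel_system => z N) xy).
- apply/seteqP; split=> [_ [g _ <-] M N leMN|x xlim]; first exact: kernel_map_proj.
  pose B (N : kernel_index) := [set g | kernel_proj N g = x N].
  have Bfil : ProperFilter (filter_from [set: kernel_index] B).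
    apply: filter_from_proper; last first.
      by move=> N _; exists (kernel_lift (x N : kernel_obj N)); exact: kernel_liftK.
    apply: filter_from_filter; first by have [N] := kernel_inhabited; exists N.
    move=> M N _ _; have [L [ML NL]] := kernel_directed M N.
    exists L => // g gL; split.
      by rewrite /B /= -(xlim _ _ ML) -(kernel_map_proj ML) gL.
    by rewrite /B /= -(xlim _ _ NL) -(kernel_map_proj NL) gL.
  have [g [_ gB]] := residually_compact resG Bfil filterT.
  exists g => //; apply: functional_extensionality_dep => N.
  have [h [hx hg]] : B N `&` [set h | kernel_proj N h = kernel_proj N g] !=set0.
    apply: gB; first by exists N.
    by apply: open_nbhs_nbhs; split=> //; exact: kernel_proj_open.
  by rewrite /f -hg.
- move=> U; split=> [oU|[V oV ->]]; last first.
    move/continuousP: (prod_continuous (f := f) (@kernel_proj_continuous)).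
    exact.
  pose cyl N (q : kernel_obj N) : set (isys_product kernel_system) :=
    (fun x => x N) @^-1` [set q].
  exists (\bigcup_(N in [set: kernel_index]) \bigcup_(q in
    [set q : kernel_obj N | kernel_proj N @^-1` [set q] `<=` U]) cyl N q).
    apply: bigcup_open => N _; apply: bigcup_open => q _.
    apply: open_comp => [x _|]; first exact: coord_continuous.
    exact: discrete_open.
  apply/seteqP; split=> [g Ug|g [N _ [q qU gq]]]; last exact: qU.
  have [|N NU] := @small_kernel ((fun h => g * h) @^-1` U).
    split; last by rewrite /= mulg1.
    apply: open_comp oU => h _.
    exact: continuous_mull.
  exists N => //; exists (kernel_proj N g) => // h /= hg.
  rewrite -(mulVKg g h); apply: NU; apply/kernel_proj_eq.
  by rewrite hg.
Qed.

Lemma residually_pro : pro C G.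
Proof.
exists kernel_system; last exact: kernel_limit.
by move=> N; have [[]] := kernel_projP N.
Qed.

End QuotientSystem.

(** * Closed subgroups and generation *)

Definition make_hom (G K : topGroupType) (f : G -> K)
    (fM : {morph f : x y / x * y}) (cf : continuous f) : contHom G K :=
  HB.pack f (isMultiplicative.Build G K f fM)
    (Multiplicative_isUMagmaMorphism.Build G K f (morph_one fM))
    (isContinuous.Build G K f cf).

Section ClosedSubgroup.
Variables (G : topGroupType) (M : subgroup G).

Definition subgroup_elt (g : G) (Mg : (M : set G) g) : set_type M :=
  exist _ g (mem_set Mg).

Lemma subgroup_valP (x : set_type M) : (M : set G) (subgroup_val x).
Proof. exact/set_mem/(valP x). Qed.

Lemma subgroup_val_inj : injective (@subgroup_val G M).
Proof. exact: val_inj. Qed.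

Lemma subgroup_valM x y : subgroup_val (x * y : set_type M) = subgroup_val x * subgroup_val y.
Proof. by []. Qed.

Lemma into_subgroup_continuous (T : topologicalType) (f : T -> set_type M) :
  continuous (fun x => subgroup_val (f x)) -> continuous f.
Proof. exact: (@continuous_comp_initial _ _ _ (\val : set_type M -> G)). Qed.

(** Finite quotients restrict to the subgroup, since they need not be
    surjective. *)
Lemma closed_subgroup_pro (C : group_class) :
  variety C -> pro C G -> closed (M : set G) -> pro C (set_type M).
Proof.
move=> varC /pro_residually [cG hG qG] clM; apply: residually_pro => //; split.
- move=> F FF _.
  have cM : compact (M : set G) by exact: subclosed_compact clM cG _.
  have [|y [My yF]] := cM (@subgroup_val G M @ F) _.
    rewrite /nbhs /=; apply: filterS filterT => x _; exact: subgroup_valP.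
  exists (subgroup_elt My); split=> // S B FS.
  rewrite nbhsE => -[B' [[V oV <-] B'x] sB'].
  have [z [[w Sw <-] Vz]] : (@subgroup_val G M @` S) `&` V !=set0.
    apply: yF; last by apply: open_nbhs_nbhs; split=> //; exact: B'x.
    by rewrite /nbhs /=; apply: filterS FS => u Su; exists u.
  by exists w; split=> //; apply: sB'.
- move=> x y xy; apply: subgroup_val_inj; apply: hG => U V Ux Vy.
  have [z [Uz Vz]] := xy _ _ (subgroup_val_continuous Ux) (subgroup_val_continuous Vy).
  by exists (subgroup_val z).
move=> U [[V oV <-] V1].
have [|Q [f [[CQ fM fO] fV]]] := qG V; first by split.
exists Q, (f \o @subgroup_val G M); split=> [|g]; last exact: fV.
split=> //; first by move=> x y; rewrite /= subgroup_valM fM.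
move=> q; rewrite comp_preimage.
by apply: open_comp (fO q) => x _; exact: subgroup_val_continuous.
Qed.

Definition corestrict (K : topGroupType) (f : contHom K G)
  (fM : forall x, (M : set G) (f x)) : K -> set_type M :=
  fun x => subgroup_elt (fM x).

Lemma corestrictM (K : topGroupType) (f : contHom K G) (fM : forall x, (M : set G) (f x)) :
  {morph corestrict fM : x y / x * y}.
Proof. by move=> x y; apply: subgroup_val_inj; rewrite subgroup_valM; exact: gmulfM. Qed.

Lemma corestrict_continuous (K : topGroupType) (f : contHom K G)
  (fM : forall x, (M : set G) (f x)) : continuous (corestrict fM).
Proof. by apply: into_subgroup_continuous; exact: cts_fun. Qed.

End ClosedSubgroup.

Section Generation.
Variables (C : group_class) (I : Type) (G : topGroupType) (X : I -> topGroupType).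
Variable iota : forall i, contHom (X i) G.
Hypotheses (varC : variety C) (freeG : free_product C iota).

(** A free product retracts onto every closed subgroup containing the images of
    the factors, and by uniqueness the retraction is the identity. *)
Lemma free_product_generated (M : subgroup G) : closed (M : set G) ->
  (forall i x, (M : set G) (iota i x)) -> forall g, (M : set G) g.
Proof.
move=> clM iM g.
pose lam_ i : contHom (X i) (set_type M) :=
  make_hom (@corestrictM _ _ _ _ (iM i)) (@corestrict_continuous _ _ _ _ (iM i)).
have [||r rE _] := @free_product_universal _ _ _ _ _ freeG (set_type M) lam_.
- by apply: closed_subgroup_pro => //; exact: free_product_pro freeG.
- move=> U [[V oV <-] V1].
  have /(free_product_convergent freeG) : open_nbhs 1 V by split.
  apply: sub_finite_set => i /= ni iV; apply: ni => _ [x _ <-].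
  by apply: iV; exists x.
have [||s _ sE] := @free_product_universal _ _ _ _ _ freeG G iota.
- exact: free_product_pro freeG.
- exact: free_product_convergent freeG.
have rM : {morph (@subgroup_val G M \o r) : x y / x * y}.
  by move=> x y; rewrite /= gmulfM.
have rc : continuous (@subgroup_val G M \o r).
  move=> x; apply: continuous_comp; first exact: cts_fun.
  exact: subgroup_val_continuous.
have idc : continuous (fun x : G => x) by move=> x; exact: cvg_id.
have := sE (make_hom rM rc) => /(_ _ g) rg.
have := sE (@make_hom G G id (fun x y => erefl) idc) => /(_ _ g) ig.
have -> : g = subgroup_val (r g).
  by rewrite [LHS]ig //; apply: esym; apply: rg => i x /=; have /= -> := rE i x.
exact: subgroup_valP.
Qed.

End Generation.

(** * Wreath products *)

Lemma isog_class (C : group_class) (gT hT : finGroupType) (G : {group gT})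
  (H : {group hT}) : variety C -> G \isog H -> C gT G -> C hT H.
Proof.
move=> varC /isogP [f _ fGH] CG; have := variety_image varC f CG.
by congr (C _ _); apply/val_inj.
Qed.

Lemma morphism_class (C : group_class) (gT hT : finGroupType) (G : {group gT})
    (H : {group hT}) (f : {morphism G >-> hT}) : extension_closed_variety C ->
  f @* G \subset H -> C hT H -> C gT ('ker f)%G -> C gT G.
Proof.
move=> extC fGH CH Ck; apply: (variety_extension extC (ker_normal f)) => //.
apply: (isog_class extC _ (variety_subgroup extC fGH CH)).
by rewrite isog_sym; exact: first_isog.
Qed.

Lemma trivial_class (C : group_class) (gT : finGroupType) :
  variety C -> C gT 1%G.
Proof.
move=> varC; have [hT [H CH]] := variety_nonempty varC.
have := variety_image varC (@triv_morph hT gT H) CH.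
congr (C _ _); apply/val_inj => /=; exact: morphim_trivm.
Qed.

(** Cocycles depend on a point of the coset space which is locally constant in
    the group element; this lemma removes that dependence from all continuity
    proofs. *)
Lemma continuous_piecewise (T K : topologicalType) (P : Type) (f : T -> P)
    (g : P -> T -> K) :
  (forall p, open (f @^-1` [set p])) -> (forall p, continuous (g p)) ->
  continuous (fun x => g (f x) x).
Proof.
move=> fo cg; apply/continuousP => A oA.
rewrite (_ : _ @^-1` A = \bigcup_(p in [set: P]) (f @^-1` [set p] `&` g p @^-1` A)).
  apply: bigcup_open => p _; apply: openI; first exact: fo.
  by move/continuousP: (cg p); apply.
by apply/seteqP; split=> x /=; [exists (f x) | move=> [p _ [/= <-]]].
Qed.

Lemma open_fiber_comp (T : topologicalType) (P R : Type) (f : T -> P) (h : P -> R) :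
  (forall p, open (f @^-1` [set p])) -> forall r, open ((fun x => h (f x)) @^-1` [set r]).
Proof.
move=> fo r; rewrite (_ : _ @^-1` _ = \bigcup_(p in h @^-1` [set r]) f @^-1` [set p]).
  by apply: bigcup_open.
by apply/seteqP; split=> x /=; [exists (f x) | move=> [p /= <- <-]].
Qed.

(** The base group consists of functions on the [Q]-set [S], with
    (a, q)(b, p) = (s |-> a(s) b(s.q), qp): a homomorphism g |-> (c(-, g), f(g))
    to it is exactly a cocycle c(s, gh) = c(s, g) c(s.f(g), h). A finite function
    type is used so that the same group law serves finite groups, giving finite
    groups, and topological ones. *)
Definition wreath (Q : finGroupType) (S : finType) (to : {action Q &-> S})
  (K : Type) : Type := ({ffun S -> K} * Q)%type.

Section WreathGroup.
Variables (Q : finGroupType) (S : finType) (to : {action Q &-> S}).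

HB.instance Definition _ (K : choiceType) :=
  Choice.copy (wreath to K) ({ffun S -> K} * Q)%type.
HB.instance Definition _ (K : finType) :=
  Finite.copy (wreath to K) ({ffun S -> K} * Q)%type.

Section Group.
Variable K : groupType.
Implicit Types w : wreath to K.

Definition wreath_mul w1 w2 : wreath to K :=
  ([ffun s => w1.1 s * w2.1 (to s w1.2)], w1.2 * w2.2).
Definition wreath_one : wreath to K := ([ffun=> 1], 1).
Definition wreath_inv w : wreath to K :=
  ([ffun s => (w.1 (to s w.2^-1))^-1], w.2^-1).

Fact wreath_mulA : associative wreath_mul.
Proof.
move=> w1 w2 w3; congr pair; last exact: mulgA.
by apply/ffunP=> s; rewrite !ffunE /= mulgA actM.
Qed.

Fact wreath_mul1 : left_id wreath_one wreath_mul.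
Proof.
move=> [a q]; congr pair; last exact: mul1g.
by apply/ffunP=> s; rewrite !ffunE /= mul1g act1.
Qed.

Fact wreath_1mul : right_id wreath_one wreath_mul.
Proof.
move=> [a q]; congr pair; last exact: mulg1.
by apply/ffunP=> s; rewrite !ffunE /= mulg1.
Qed.

Fact wreath_mulV : left_inverse wreath_one wreath_inv wreath_mul.
Proof.
move=> [a q]; congr pair; last exact: mulVg.
by apply/ffunP=> s; rewrite !ffunE /= mulVg.
Qed.

Fact wreath_Vmul : right_inverse wreath_one wreath_inv wreath_mul.
Proof.
move=> [a q]; congr pair; last exact: mulgV.
by apply/ffunP=> s; rewrite !ffunE /= -actM mulgV act1 mulgV.
Qed.

HB.instance Definition _ := isGroup.Build (wreath to K)
  wreath_mulA wreath_mul1 wreath_1mul wreath_mulV wreath_Vmul.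

Lemma wreathM1 w1 w2 s : (w1 * w2).1 s = w1.1 s * w2.1 (to s w1.2).
Proof. by rewrite ffunE. Qed.
Lemma wreathM2 w1 w2 : (w1 * w2).2 = w1.2 * w2.2.
Proof. by []. Qed.
Lemma wreath11 s : (1 : wreath to K).1 s = 1.
Proof. by rewrite ffunE. Qed.
End Group.

HB.instance Definition _ (K : finGroupType) := Finite.on (wreath to K).

Section FiniteWreath.
Variables (C : group_class) (extC : extension_closed_variety C).
Variables (K : finGroupType) (CK : @C K [set: K]%G) (CQ : @C Q [set: Q]%G).
Notation W := (wreath to K).

(** Adding one point to the support [r] is an extension by a subgroup of [K], so
    the base group is handled by induction on [r]. *)
Definition base_part (r : seq S) : {set W} :=
  [set w : W | (w.2 == 1) && [forall s, (s \notin r) ==> (w.1 s == 1)]]%SET.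

Lemma base_partP r (w : W) :
  reflect (w.2 = 1 /\ forall s, s \notin r -> w.1 s = 1) (w \in base_part r).
Proof.
rewrite finset.inE; apply: (iffP andP) => [[/eqP -> /forallP w1]|[-> w1]].
  by split=> // s sr; have := w1 s; rewrite sr => /eqP.
by split=> //; apply/forallP => s; apply/implyP => /w1 ->.
Qed.

Fact base_part_group r : group_set (base_part r).
Proof.
apply/group_setP; split; first by apply/base_partP; split=> // s _; rewrite wreath11.
move=> x y /base_partP [x2 x1] /base_partP [y2 y1]; apply/base_partP.
split=> [|s sr]; first by rewrite wreathM2 x2 y2 mulg1.
by rewrite wreathM1 x2 act1 x1 // y1 // mulg1.
Qed.
Canonical base_part_gp r := Group (base_part_group r).

Lemma base_part_class r : @C W (base_part_gp r).
Proof.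
elim: r => [|s r IHr].
  have -> : base_part_gp [::] = 1%G; last exact: (@trivial_class C _ extC).
  apply/val_inj/setP => w /=; apply/base_partP/finset.set1P => [[w2 w1]|->].
    rewrite (surjective_pairing w) w2; congr pair.
    by apply/ffunP => s; rewrite w1 // ffunE.
  by split=> // s _; rewrite wreath11.
have evM : {in base_part_gp (s :: r) &, {morph (fun w : W => w.1 s) : x y / x * y}}.
  by move=> x y /base_partP [x2 _] _; rewrite /= wreathM1 x2 act1.
apply: (@morphism_class C _ _ _ [set: K]%G (Morphism evM)) => //.
  exact: finset.subsetT.
apply: (variety_subgroup extC _ IHr).
apply/fintype.subsetP => w /morphpreP [/base_partP [w2 w1] /finset.set1P /= ws].
apply/base_partP; split=> // t tr; have [->|ts] := eqVneq t s; first exact: ws.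
by apply: w1; rewrite in_cons negb_or ts tr.
Qed.

(** This is where extension closure enters: the base group and the top group are
    in the class, hence so is the wreath product. *)
Lemma wreath_class : @C W [set: W]%G.
Proof.
have sndM : {in [set: W]%SET &, {morph (fun w : W => w.2) : x y / x * y}} by [].
apply: (@morphism_class C _ _ _ [set: Q]%G (Morphism sndM)) => //.
  exact: finset.subsetT.
have -> : ('ker (Morphism sndM))%G = base_part_gp (enum S); last exact: base_part_class.
apply/val_inj/setP => w /=; apply/idP/base_partP => [/morphpreP [_ /finset.set1P w2]|[w2 _]].
  by split=> // s; rewrite mem_enum.
by apply/morphpreP; split; rewrite ?finset.in_setT //; apply/finset.set1P.
Qed.

End FiniteWreath.
End WreathGroup.

Section WreathTopology.
Variables (Q : finGroupType) (S : finType) (to : {action Q &-> S}).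
Variable (K : topGroupType).
Notation W := (wreath to K).

Definition wreath_coord (w : W) : {ptws S -> K} * discrete_topology Q :=
  (w.1 : S -> K, w.2).

HB.instance Definition _ := Topological.copy W (initial_topology wreath_coord).

Lemma wreath_cvg (F : set_system W) (w : W) : Filter F ->
  (forall s, (fun u : W => u.1 s) @ F --> w.1 s) ->
  F [set u | u.2 = w.2] -> F --> w.
Proof.
move=> FF c1 c2 U [_ [[B oB <-] Bw] sB]; apply: filterS sB _.
have : wreath_coord @ F --> wreath_coord w.
  have h1 : (fun u : W => (u.1 : S -> K) : {ptws S -> K}) @ F -->
      ((w.1 : S -> K) : {ptws S -> K}) by exact: prod_cvg.
  have h2 : (fun u : W => u.2 : discrete_topology Q) @ F -->
      (w.2 : discrete_topology Q) by apply/discrete_cvg.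
  exact: cvg_pair h1 h2.
by apply; apply: open_nbhs_nbhs.
Qed.

Lemma wreath1_continuous s : continuous (fun w : W => w.1 s).
Proof.
move=> w; apply: (@continuous_comp _ _ _ wreath_coord (fun p => p.1 s)).
  exact: initial_continuous.
apply: (@continuous_comp _ _ _ fst (fun p : {ptws S -> K} => p s)).
  exact: cvg_fst.
exact: (@proj_continuous _ (fun=> K) s).
Qed.

Lemma wreath2_open q : open [set w : W | w.2 = q].
Proof.
rewrite (_ : [set w | _] =
    wreath_coord @^-1` (snd @^-1` ([set q] : set (discrete_topology Q)))) //.
apply: open_comp => [w _|]; first exact: initial_continuous.
by apply: open_comp (discrete_open _) => w _; exact: cvg_snd.
Qed.

Lemma into_wreath_continuous (T : topologicalType) (f : T -> W) :
  (forall s, continuous (fun x => (f x).1 s)) ->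
  (forall q, open [set x | (f x).2 = q]) -> continuous f.
Proof.
move=> c1 c2 x; apply: wreath_cvg => [s|]; first exact: c1.
by apply: open_nbhs_nbhs; split=> //; exact: c2.
Qed.

Fact wreath_mul_continuous : continuous (fun ww : W * W => ww.1 * ww.2).
Proof.
have f1 : continuous (fun ww : W * W => ww.1) by move=> ww; exact: cvg_fst.
have f2 : continuous (fun ww : W * W => ww.2) by move=> ww; exact: cvg_snd.
have o1 q : open [set ww : W * W | ww.1.2 = q].
  by apply: (open_comp _ (wreath2_open q)) => ww _; exact: f1.
have o2 q : open [set ww : W * W | ww.2.2 = q].
  by apply: (open_comp _ (wreath2_open q)) => ww _; exact: f2.
apply: into_wreath_continuous => [s|q].
  have -> : (fun ww : W * W => (ww.1 * ww.2).1 s) =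
      (fun ww => ww.1.1 s * ww.2.1 (to s ww.1.2)).
    by apply/funext => ww; rewrite wreathM1.
  apply: continuousM => [ww|].
    apply: (@continuous_comp _ _ _ fst (fun w : W => w.1 s)); first exact: f1.
    exact: wreath1_continuous.
  apply: (continuous_piecewise (f := fun ww : W * W => ww.1.2)
    (g := fun q ww => ww.2.1 (to s q))) => // q ww.
  apply: (@continuous_comp _ _ _ snd (fun w : W => w.1 (to s q))); first exact: f2.
  exact: wreath1_continuous.
rewrite (_ : [set _ | _] = \bigcup_(r in [set: Q])
    ([set ww : W * W | ww.1.2 = r] `&` [set ww | ww.2.2 = r^-1 * q])).
  by apply: bigcup_open => r _; exact: openI.
apply/seteqP; split=> ww /=; first by move=> <-; exists ww.1.2; rewrite // mulKg.
by move=> [r _ [-> ->]]; rewrite mulVKg.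
Qed.

Fact wreath_inv_continuous : continuous (fun w : W => w^-1).
Proof.
apply: into_wreath_continuous => [s|q].
  have -> : (fun w : W => w^-1.1 s) = (fun w => (w.1 (to s w.2^-1))^-1).
    by apply/funext => w; rewrite ffunE.
  apply: continuousV.
  apply: (continuous_piecewise (f := fun w : W => w.2)
    (g := fun q w => w.1 (to s q^-1))) => [q|q].
    exact: wreath2_open.
  exact: wreath1_continuous.
rewrite (_ : [set _ | _] = [set w : W | w.2 = q^-1]); first exact: wreath2_open.
by apply/seteqP; split=> w /=; [move=> <-; rewrite invgK|move=> ->; rewrite invgK].
Qed.

HB.instance Definition _ :=
  isTopGroup.Build W wreath_mul_continuous wreath_inv_continuous.

Lemma wreath_nbhs1 (U : set W) : open_nbhs 1 U ->
  exists2 V : set K, open_nbhs 1 V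
    & [set w : W | w.2 = 1 /\ forall s, V (w.1 s)] `<=` U.
Proof.
move=> oU; pose B (V : set K) := [set w : W | w.2 = 1 /\ forall s, V (w.1 s)].
have Bfil : Filter (filter_from (nbhs (1 : K)) B).
  apply: filter_from_filter; first by exists setT; exact: filterT.
  move=> V V' nV nV'; exists (V `&` V'); first exact: filterI.
  by move=> w [w2 wV]; split; split=> // s; have [] := wV s.
have [V nV BVU] : filter_from (nbhs (1 : K)) B U.
  have : filter_from (nbhs (1 : K)) B --> (1 : W); last first.
    by apply; exact: open_nbhs_nbhs.
  apply: wreath_cvg => [s V|]; last by exists setT; [exact: filterT | move=> w []].
  by rewrite wreath11 => nV; exists V => // w [_]; apply.
exists V°; first by split; [exact: open_interior | exact: nV].
by move=> w [w2 wV]; apply: BVU; split=> // s; exact: interior_subset.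
Qed.

Variables (C : group_class) (extC : extension_closed_variety C).
Hypotheses (proK : pro C K) (CQ : @C Q [set: Q]%G).

(** A finite quotient of [K] induces one of the wreath product, whose kernel is
    as small as the neighbourhoods of 1 in [wreath_nbhs1] require. *)
Lemma wreath_pro : pro C W.
Proof.
have [cK hK qK] := pro_residually proK; apply: (residually_pro extC); split.
- pose psi (p : {ptws S -> K} * discrete_topology Q) : W :=
    ([ffun s => p.1 s], p.2).
  rewrite (_ : setT = psi @` setT); last first.
    apply/seteqP; split=> // w _; exists (wreath_coord w) => //.
    by rewrite [RHS]surjective_pairing; congr pair; apply/ffunP => s; rewrite ffunE.
  apply: continuous_compact.
    apply: continuous_subspaceT; apply: into_wreath_continuous => [s|q].
      rewrite (_ : (fun x => _) = (fun p => p.1 s)).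
        move=> p; apply: (@continuous_comp _ _ _ fst (fun p : {ptws S -> K} => p s)).
          exact: cvg_fst.
        exact: (@proj_continuous _ (fun=> K) s).
      by apply/funext => p; rewrite ffunE.
    rewrite (_ : [set x | _] = snd @^-1` ([set q] : set (discrete_topology Q))) //.
    by apply: open_comp (discrete_open _) => w _; exact: cvg_snd.
  rewrite -setXTT; apply: compact_setX.
    have := @tychonoff S (fun=> K) (fun=> setT) (fun=> cK).
    by congr compact; apply/seteqP; split.
  have := @finite_compact (discrete_topology Q) setT.
  by apply; exact: (@finite_finset Q).
- move=> w v wv.
  suff ws s : w.1 s = v.1 s.
    have w2 : w.2 = v.2; last first.
      by rewrite [LHS]surjective_pairing [RHS]surjective_pairing w2; congr pair; apply/ffunP.
    have on (u : W) : nbhs u [set z : W | z.2 = u.2].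
      by apply: open_nbhs_nbhs; split=> //; exact: wreath2_open.
    by have [z [/= <- <-]] := wv _ _ (on w) (on v).
  apply: hK => U V Us Vs.
  have [z [/= Uz Vz]] := wv _ _ (wreath1_continuous Us) (wreath1_continuous Vs).
  by exists (z.1 s).
move=> U /wreath_nbhs1 [V /qK [P [f [[CP fM fO] fV]]] BVU].
pose F (w : W) : wreath to P := ([ffun s => f (w.1 s)], w.2).
exists (wreath to P), F; split; last first.
  move=> w Fw; apply: BVU; split; first exact: (congr1 snd Fw).
  move=> s; apply: fV.
  by have /ffunP/(_ s) := congr1 fst Fw; rewrite !ffunE.
split; first exact: wreath_class.
  move=> x y; congr pair; apply/ffunP => s.
  by rewrite !ffunE /= fM.
move=> p; rewrite (_ : _ @^-1` _ = [set w | w.2 = p.2] `&`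
    \bigcap_(s in [set: S]) (fun w : W => w.1 s) @^-1` (f @^-1` [set p.1 s])).
  apply: openI; first exact: wreath2_open.
  rewrite openE => w fw; apply: filterS (filter_forall (f := fun s =>
    (fun w : W => w.1 s) @^-1` (f @^-1` [set p.1 s])) (F := nbhs w) _ _).
    by move=> v fv s _; exact: fv.
  move=> s; apply: open_nbhs_nbhs; split; last exact: fw.
  by apply: open_comp (fO _) => v _; exact: wreath1_continuous.
apply/seteqP; split=> w /=.
  by move=> <-; split=> // s _; rewrite /= ffunE.
move=> [w2 w1]; rewrite [RHS]surjective_pairing -w2; congr pair.
by apply/ffunP => s; rewrite ffunE; exact: w1.
Qed.

End WreathTopology.

(** * Cocycles on the coset space *)

Lemma open_fiber_closed (T : topologicalType) (P : Type) (f : T -> P) (B : set P) :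
  (forall p, open (f @^-1` [set p])) -> closed (f @^-1` B).
Proof.
move=> fo; rewrite -[X in closed X]setCK; apply: open_closedC.
rewrite (_ : ~` _ = \bigcup_(p in ~` B) f @^-1` [set p]).
  by apply: bigcup_open.
by apply/seteqP; split=> x /=; [exists (f x) | move=> [p nBp /= ->]].
Qed.

Section Cocycles.
Variables (C : group_class) (extC : extension_closed_variety C).
Variables (A : Type) (X : A -> topGroupType) (G : topGroupType).
Variable iota : forall a, contHom (X a) G.
Hypothesis freeG : free_product C iota.
Variables (Q : finGroupType) (f : G -> Q).
Hypothesis quoQ : finite_quotient C f.
Variables (S : finType) (to : {action Q &-> S}).

(** The universal property for cocycles: a cocycle with values in [K] is a
    homomorphism to a wreath product whose top component is [f], and the wreath
    product is again pro-C. *)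
Lemma cocycle_extension (K : topGroupType) (c : forall a, S -> X a -> K) :
  pro C K ->
  (forall a s x y, c a s (x * y) = c a s x * c a (to s (f (iota a x))) y) ->
  (forall a s, continuous (c a s)) ->
  (forall U : set K, open_nbhs 1 U ->
    finite_set [set a | ~ forall s x, U (c a s x)]) ->
  exists b : S -> G -> K,
    [/\ forall s, continuous (b s),
        forall s g h, b s (g * h) = b s g * b (to s (f g)) h
      & forall a s x, b s (iota a x) = c a s x].
Proof.
move=> proK cM cc cconv; have [CQ fM fo] := quoQ.
pose w a (x : X a) : wreath to K := ([ffun s => c a s x], f (iota a x)).
have wM a : {morph @w a : x y / x * y}.
  move=> x y; congr pair; last by rewrite gmulfM fM.
  by apply/ffunP => s; rewrite !ffunE /= cM.
have wc a : continuous (@w a).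
  apply: into_wreath_continuous => [s|q].
    rewrite (_ : (fun x => _) = c a s); first exact: cc.
    by apply/funext => x; rewrite ffunE.
  apply: (@open_comp _ _ (iota a) (f @^-1` [set q])); last exact: fo.
  by move=> x _; exact: cts_fun.
pose lam_ a : contHom (X a) (wreath to K) := make_hom (@wM a) (@wc a).
have [||l lE _] := @free_product_universal _ _ _ _ _ freeG (wreath to K) lam_.
- exact: wreath_pro.
- move=> U /wreath_nbhs1 [V oV VU].
  have kf : open_nbhs 1 (f @^-1` [set 1]).
    by split; [exact: fo | exact: (morph_one fM)].
  have := cconv _ oV; have := free_product_convergent freeG kf.
  move=> fin1 fin2; have fin := conj fin1 fin2; move: fin; rewrite -finite_setU.
  apply: sub_finite_set => a /= nU.
  apply/not_andP => -[h1 h2]; apply: nU => _ [x _ <-]; apply: VU; split.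
    by apply: h1; exists x.
  by move=> s; rewrite ffunE; exact: h2.
(* The top component agrees with [f] on the factors, hence everywhere. *)
have l2 g : (l g).2 = f g.
  pose E := [set g | (l g).2 = f g].
  have E1 : E 1 by rewrite /E /= gmulf1 (morph_one fM).
  have EM x y : E x -> E y -> E (x * y).
    by rewrite /E /= gmulfM wreathM2 fM => -> ->.
  have EV x : E x -> E x^-1.
    by rewrite /E /= gmulfV (morph_inv fM) => <-.
  apply: (free_product_generated extC freeG (M := Subgroup E1 EM EV)); last first.
    by move=> a x; have := lE a x => /= ax; rewrite /E /= ax.
  change (closed ((fun g => ((l g).2, f g)) @^-1` [set p | p.1 = p.2])).
  apply: open_fiber_closed => -[p q].
  rewrite (_ : _ @^-1` _ = [set g | (l g).2 = p] `&` f @^-1` [set q]).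
    apply: openI; last exact: fo.
    apply: (@open_comp _ _ l [set w : wreath to K | w.2 = p]); last exact: wreath2_open.
    by move=> x _; exact: cts_fun.
  by apply/seteqP; split=> x /=; [move=> [-> ->] | move=> [-> ->]].
exists (fun s g => (l g).1 s); split.
- move=> s g; apply: (@continuous_comp _ _ _ l (fun w : wreath to K => w.1 s)).
    exact: cts_fun.
  exact: wreath1_continuous.
- by move=> s g h; rewrite gmulfM wreathM1 l2.
- by move=> a s x; have /= -> := lE a x; rewrite ffunE.
Qed.

End Cocycles.

(** The space of right cosets of [H] as a finite set with an action of a finite
    quotient through which the action of [G] factors. *)
Lemma coset_action (C : group_class) (G : topGroupType) (H : subgroup G) :
  variety C -> pro C G -> open (H : set G) ->
  exists (Q : finGroupType) (f : G -> Q) (S : finType) (to : {action Q &-> S})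
    (s0 : S), [/\ finite_quotient C f,
      forall g, (H : set G) g <-> to s0 (f g) = s0
    & forall s, exists g, to s0 (f g) = s].
Proof.
move=> varC proG oH.
have [|Q0 [f0 [quo0 f0H]]] := residually_quotient (pro_residually proG) (U := H).
  by split; [| exact: subgroup1].
have [Q [f [quo fT fE]]] := finite_quotient_onto varC quo0.
have [CQ fM fo] := quo.
have Hker g h : f g = f h -> (H : set G) g -> (H : set G) h.
  move=> /fE gh Hg; rewrite -(mulVKg g h); apply: subgroupM => //.
  by apply: f0H; rewrite (finquoM quo0) (morph_inv (finquoM quo0)) gh mulVg.
have Pg : group_set [set q : Q | `[< (f @` (H : set G)) q >]]%SET.
  apply/group_setP; split=> [|x y].
    rewrite finset.inE; apply/asboolP; exists 1; first exact: subgroup1.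
    exact: morph_one.
  rewrite !finset.inE => /asboolP hx /asboolP hy; apply/asboolP.
  move: hx hy => [a Ha <-] [b Hb <-]; exists (a * b); first exact: subgroupM.
  by rewrite fM.
pose P := Group Pg.
have PP g : f g \in P <-> (H : set G) g.
  rewrite finset.inE; split=> [/asboolP|Hg]; last by apply/asboolP; exists g.
  by move=> [h Hh hg]; apply: Hker hg Hh.
pose S := {U : {set Q} | U \in rcosets P [set: Q]%SET}.
have actS (U : S) q : val U :* q \in rcosets P [set: Q]%SET.
  have /rcosetsP [x _ ->] := valP U.
  by apply/rcosetsP; exists (x * q); rewrite ?finset.in_setT // rcosetM.
pose act (U : S) q : S := Sub (val U :* q) (actS U q).
have act1 : act^~ 1 =1 id by move=> U; apply/val_inj; rewrite /= rcoset1.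
have act_actM U : act_morph act U by move=> p q; apply/val_inj; rewrite /= rcosetM.
pose to := TotalAction act1 act_actM.
have PS : (P : {set Q}) \in rcosets P [set: Q]%SET.
  by apply/rcosetsP; exists 1; rewrite ?finset.in_setT // rcoset1.
exists Q, f, S, to, (Sub (P : {set Q}) PS); split=> // [g|U].
  split=> [/PP Pg'|/(congr1 val) /= Pg'].
    apply/val_inj => /=; exact: (rcoset_id Pg').
  apply/PP; have := rcoset_refl P (f g).
  by move: Pg'; rewrite /rcoset => ->.
have /rcosetsP [x _ Ux] := valP U.
have [g _ gx] : range f x by rewrite fT.
by exists g; apply/val_inj; rewrite /= gx -Ux.
Qed.

(** * Coset representatives along a spanning tree *)

Section Transversals.
Variables (A : Type) (X : A -> topGroupType) (G : topGroupType).
Variable iota : forall a, contHom (X a) G.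
Variables (Q : finGroupType) (f : G -> Q).
Variables (S : finType) (to : {action Q &-> S}) (s0 : S).

Definition factor_act a (s : S) (x : X a) : S := to s (f (iota a x)).

(** A base point in each orbit of each factor on the coset space, elements of the
    factor leading from it to the other points of the orbit, and representatives
    of the cosets chosen along a spanning tree rooted at [s0]: the tree joins a
    point with parent [a] to the base point of its orbit under the factor [a].
    The field [kurosh_ind] says that every branch of the tree reaches the
    root. *)
Record kurosh_system := KuroshSystem {
  orbit_rep : A -> S -> S;
  orbit_shift : forall a, S -> X a;
  tree_parent : S -> option A;
  coset_rep : S -> G;
  orbit_rep_act : forall a s (x : X a), orbit_rep a (factor_act s x) = orbit_rep a s;
  orbit_rep_shift : forall a s, factor_act (orbit_rep a s) (orbit_shift a s) = s;
  orbit_shift_rep : forall a s, orbit_rep a s = s -> orbit_shift a s = 1;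
  coset_rep1 : coset_rep s0 = 1;
  coset_rep_parent : forall s a, tree_parent s = Some a ->
    coset_rep s = coset_rep (orbit_rep a s) * iota a (orbit_shift a s);
  kurosh_ind : forall P : S -> Prop, P s0 ->
    (forall s a, tree_parent s = Some a -> P (orbit_rep a s) -> P s) -> forall s, P s
}.

Hypothesis fM : {morph f : x y / x * y}.

Lemma factor_act1 a s : factor_act s (1 : X a) = s.
Proof. by rewrite /factor_act gmulf1 (morph_one fM) act1. Qed.

Lemma factor_actM a s (x y : X a) :
  factor_act s (x * y) = factor_act (factor_act s x) y.
Proof. by rewrite /factor_act gmulfM fM actM. Qed.

Lemma factor_actK a s (x : X a) : factor_act (factor_act s x) x^-1 = s.
Proof. by rewrite -factor_actM mulgV factor_act1. Qed.

Fixpoint reach n (s : S) : Prop :=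
  if n is m.+1 then exists a (x : X a) s', reach m s' /\ s = factor_act s' x
  else s = s0.

Hypothesis reach_all : forall s, exists n, reach n s.

(** Base points are chosen as near to the root as possible. The last move of a
    shortest path to a point other than the root runs inside an orbit meeting a
    smaller distance, so the base point of that orbit is nearer to the root and
    can serve as the neighbour of the point in the tree. *)
Lemma kurosh_system_exists : inhabited kurosh_system.
Proof.
have ex s : exists n, `[< reach n s >] by have [n h] := reach_all s; exists n; apply/asboolP.
pose d s := ex_minn (ex s).
pose orb a s := [set u | `[< exists x : X a, factor_act s x = u >]]%SET.
have orbP a s u : u \in orb a s <-> exists x : X a, factor_act s x = u.
  by rewrite finset.inE; split=> [/asboolP|h] //; apply/asboolP.
have orb_act a s (x : X a) : orb a (factor_act s x) = orb a s.
  apply/setP => u; apply/idP/idP => /orbP [y <-]; apply/orbP.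
    by exists (x * y); rewrite factor_actM.
  by exists (x^-1 * y); rewrite factor_actM factor_actK.
(* The default [s0] is never taken: orbits are nonempty. A choice depending on
   the orbit as a set is constant along it. *)
pose least (O : {set S}) := odflt s0 [pick u in O | [forall v in O, d u <= d v]].
have leastP a s : least (orb a s) \in orb a s /\
    forall v, v \in orb a s -> d (least (orb a s)) <= d v.
  rewrite /least; case: pickP => [u /andP [uO /forallP du]|none] /=.
    by split=> // v vO; have := du v; rewrite vO.
  have ss : s \in orb a s by apply/orbP; exists 1; exact: factor_act1.
  case: (arg_minnP d ss) => u uO du; have /negbT/negP := none u; case.
  by apply/andP; split=> //; apply/forallP => v; apply/implyP; exact: du.
pose rp a s := least (orb a s).
have rp_act a s (x : X a) : rp a (factor_act s x) = rp a s by rewrite /rp orb_act.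
have shift_ex a s : exists x : X a, factor_act (rp a s) x = s /\ (rp a s = s -> x = 1).
  have [rs|rs] := eqVneq (rp a s) s; first by exists 1; rewrite factor_act1.
  have [/orbP [x sx] _] := leastP a s.
  exists x^-1; rewrite -[X in factor_act X]sx factor_actK; split=> // rs'.
  by rewrite rs' eqxx in rs.
pose sh a s := projT1 (cid (shift_ex a s)).
have shP a s : factor_act (rp a s) (sh a s) = s /\ (rp a s = s -> sh a s = 1).
  exact: (projT2 (cid (shift_ex a s))).
have d_rp s : s <> s0 -> exists a, d (rp a s) < d s.
  move=> ss0; rewrite {2}/d; case: ex_minnP => -[|n] /asboolP //.
  move=> [a [x [s' [rs' ->]]]] _; exists a; rewrite rp_act ltnS.
  have ss' : s' \in orb a s' by apply/orbP; exists 1; exact: factor_act1.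
  apply: leq_trans ((leastP a s').2 _ ss') _.
  by rewrite /d; case: ex_minnP => m _; apply; apply/asboolP.
pose par s := if pselect (exists a, d (rp a s) < d s) is left h
  then Some (projT1 (cid h)) else None.
have parP s a : par s = Some a -> d (rp a s) < d s.
  by rewrite /par; case: pselect => // h [<-]; exact: (projT2 (cid h)).
(* Recursion along the tree with the distance to the root as fuel. *)
pose fix tr (n : nat) (s : S) {struct n} : G := if n is m.+1 then
  if par s is Some a then tr m (rp a s) * iota a (sh a s) else 1 else 1.
have tr_stable n m s : d s < n -> d s < m -> tr n s = tr m s.
  elim: n m s => [|n IHn] [|m] s //; rewrite !ltnS => dn dm /=.
  case ps: (par s) => [a|] //; have da := parP _ _ ps.
  by congr (_ * _); apply: IHn; apply: leq_trans da _.
split; apply: (@KuroshSystem rp sh par (fun s => tr (d s).+1 s)).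
- exact: rp_act.
- by move=> a s; have [] := shP a s.
- by move=> a s; have [_] := shP a s.
- rewrite /=; case ps: (par s0) => [a|] //; have := parP _ _ ps.
  suff -> : d s0 = 0 by [].
  rewrite /d; case: ex_minnP => n _ /(_ 0).
  by rewrite leqn0 => /(_ _)/eqP; apply; apply/asboolP.
- move=> s a ps; rewrite [in LHS]/= ps; congr (_ * _).
  by apply: tr_stable => //; exact: parP.
move=> P P0 PS s; elim: {s}(d s).+1 {-2}s (ltnSn (d s)) => // n IHn s.
rewrite ltnS => dn; have [->//|/eqP/d_rp h] := eqVneq s s0.
case ps: (par s) => [a|]; last by move: ps; rewrite /par; case: pselect.
by apply: (PS _ _ ps); apply: IHn; apply: leq_trans (parP _ _ ps) dn.
Qed.

End Transversals.

Section Reachability.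
Variables (C : group_class) (varC : variety C).
Variables (A : Type) (X : A -> topGroupType) (G : topGroupType).
Variable iota : forall a, contHom (X a) G.
Hypothesis freeG : free_product C iota.
Variables (Q : finGroupType) (f : G -> Q) (quoQ : finite_quotient C f).
Variables (S : finType) (to : {action Q &-> S}) (s0 : S).
Hypothesis to_trans : forall s, exists g, to s0 (f g) = s.

(** The stabilizer of the reachable set is a closed subgroup containing every
    factor, hence everything. *)
Lemma free_product_reach s : exists n, reach iota f to s0 n s.
Proof.
have [_ fM fo] := quoQ.
pose R s := exists n, reach iota f to s0 n s.
pose E := [set g | forall s, R (to s (f g)) <-> R s].
have E1 : E 1 by move=> t; rewrite (morph_one fM) act1.
have EM x y : E x -> E y -> E (x * y).
  by move=> Ex Ey t; rewrite fM actM Ey.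
have EV x : E x -> E x^-1.
  by move=> Ex t; rewrite -Ex (morph_inv fM) actKV.
have gen := free_product_generated varC freeG (M := Subgroup E1 EM EV).
have [g <-] := to_trans s.
suff : E g by move=> /(_ s0) [_ h]; apply: h; exists 0.
apply: gen => [|a x t].
  change (closed (f @^-1` [set q | forall s, R (to s q) <-> R s])).
  exact: open_fiber_closed.
split=> -[n nt]; last by exists n.+1, a, x, t.
exists n.+1, a, x^-1, (factor_act iota f to t x); split=> //.
by rewrite factor_actK.
Qed.

End Reachability.

(** * The factors of an open subgroup *)

Section Equalizer.
Variables (G K : topGroupType) (l m : contHom G K).

Definition equalizer_set : set G := [set x | l x = m x].

Fact equalizer1 : equalizer_set 1.
Proof. by rewrite /equalizer_set /= !gmulf1. Qed.
Fact equalizerM x y : equalizer_set x -> equalizer_set y -> equalizer_set (x * y).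
Proof. by move=> /= lx ly; rewrite /equalizer_set /= !gmulfM; congr (_ * _). Qed.
Fact equalizerV x : equalizer_set x -> equalizer_set x^-1.
Proof. by move=> /= lx; rewrite /equalizer_set /= !gmulfV; congr (_^-1). Qed.

Definition equalizer := Subgroup equalizer1 equalizerM equalizerV.

Lemma equalizer_closed : hausdorff_space K -> closed (equalizer : set G).
Proof.
move=> hK x xE; apply: hK => U V Ul Vm.
have nx : nbhs x (l @^-1` U `&` m @^-1` V).
  by apply: filterI; [exact: (@cts_fun _ _ l) Ul | exact: (@cts_fun _ _ m) Vm].
have [z [ez [Uz Vz]]] := xE _ nx.
by exists (l z); split=> //; rewrite ez.
Qed.

End Equalizer.

Section ImageSubgroup.
Variables (G : topGroupType) (M : subgroup G) (L : subgroup (set_type M)).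

Definition image_subgroup_set : set G := [set subgroup_val x | x in (L : set (set_type M))].

Fact image_subgroup1 : image_subgroup_set 1.
Proof. by exists 1; first exact: subgroup1. Qed.
Fact image_subgroupM x y :
  image_subgroup_set x -> image_subgroup_set y -> image_subgroup_set (x * y).
Proof. by move=> [a La <-] [b Lb <-]; exists (a * b); first exact: subgroupM. Qed.
Fact image_subgroupV x : image_subgroup_set x -> image_subgroup_set x^-1.
Proof. by move=> [a La <-]; exists a^-1; first exact: subgroupV. Qed.

Definition image_subgroup := Subgroup image_subgroup1 image_subgroupM image_subgroupV.

Lemma image_subgroupP (x : set_type M) :
  (image_subgroup : set G) (subgroup_val x) -> (L : set (set_type M)) x.
Proof. by move=> [z Lz /subgroup_val_inj <-]. Qed.

Lemma image_subgroup_closed (C : group_class) : variety C -> pro C G ->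
  closed (M : set G) -> closed (L : set (set_type M)) -> closed (image_subgroup : set G).
Proof.
move=> varC proG clM clL; apply: compact_closed.
  exact: residually_hausdorff (pro_residually proG).
apply: continuous_compact.
  by apply: continuous_subspaceT; exact: subgroup_val_continuous.
have proM := closed_subgroup_pro varC proG clM.
exact: subclosed_compact clL (residually_compact (pro_residually proM)) _.
Qed.

End ImageSubgroup.

Lemma open_subgroup_closed (G : topGroupType) (H : subgroup G) :
  open (H : set G) -> closed (H : set G).
Proof.
move=> oH x xH; have [|y [Hy]] := xH [set y | (H : set G) (x^-1 * y)].
  apply: open_nbhs_nbhs; split; last by rewrite /= mulVg; exact: subgroup1.
  by apply: open_comp oH => y _; exact: continuous_mull.
move=> Hxy; have -> : x = y * (x^-1 * y)^-1 by rewrite invgM invgK mulKVg.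
by apply: subgroupM => //; exact: subgroupV.
Qed.

Lemma finite_set_enum (T : Type) (B : set T) : finite_set B ->
  exists (F : finType) (b : F -> T),
    [/\ injective b, forall i, B (b i) & forall p, B p -> exists i, b i = p].
Proof.
move=> /(@finite_fsetP {classic T} B) [Y BY]; exists Y, val; split.
- exact: val_inj.
- by move=> i; rewrite BY /=; exact: fsvalP.
by move=> p; rewrite BY /= => pY; exists (FSetSub pY).
Qed.

Section OpenSubgroup.
Variables (C : group_class) (extC : extension_closed_variety C).
Variables (A : Type) (X : A -> topGroupType) (G : topGroupType).
Variable iota : forall a, contHom (X a) G.
Hypothesis freeG : free_product C iota.
Variables (H : subgroup G) (Q : finGroupType) (f : G -> Q).
Hypothesis quoQ : finite_quotient C f.
Variables (S : finType) (to : {action Q &-> S}) (s0 : S).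
Hypothesis HE : forall g, (H : set G) g <-> to s0 (f g) = s0.
Variable KS : kurosh_system iota f to s0.

Local Notation t := (coset_rep KS).
Local Notation r := (orbit_rep KS).
Local Notation sh := (@orbit_shift _ _ _ _ _ _ _ _ _ KS).
Local Notation act := (factor_act iota f to).
Local Notation fM := (finquoM quoQ).

Lemma actE a s (x : X a) : to s (f (iota a x)) = act s x.
Proof. by []. Qed.

Lemma orbit_rep_idem a s : r a (r a s) = r a s.
Proof. by rewrite -[in RHS](orbit_rep_shift KS a s) orbit_rep_act. Qed.

Lemma act_transversal s : to s0 (f (t s)) = s.
Proof.
move: s; apply: (kurosh_ind (k := KS)) => [|s a ps IHs].
  by rewrite coset_rep1 (morph_one fM) act1.
by rewrite (coset_rep_parent ps) fM actM IHs; exact: orbit_rep_shift.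
Qed.

(** The representatives of the double cosets of [H] and the factor [a]: these
    double cosets are the orbits of the factor on the coset space. *)
Definition double_reps a : set G := [set t s | s in [set s | r a s = s]].

Lemma double_repsP a : double_coset_reps H (hom_range (iota a)) (double_reps a).
Proof.
move=> g; set s := to s0 (f g); exists (t (r a s)); split.
  split; first by exists (r a s) => //; exact: orbit_rep_idem.
  exists (t (r a s) * iota a (sh a s) * g^-1).
    apply/HE; rewrite !fM !actM act_transversal (morph_inv fM).
    by rewrite actE orbit_rep_shift /s actK.
  exists (iota a (sh a s))^-1; last by rewrite mulgVK mulgK.
  by apply: subgroupV; exists (sh a s).
move=> _ [[s' rs' <-] [h /HE Hh [_ [x _ <-] sE]]].
have s'E : act s x = s'.
  by rewrite -[RHS]act_transversal sE !fM !actM Hh.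
by rewrite -rs' -s'E orbit_rep_act.
Qed.

Definition small_factor : set A := [set a | range (iota a) `<=` f @^-1` [set 1]].

Lemma finite_large_factor : finite_set (~` small_factor).
Proof.
apply: (free_product_convergent freeG); split; first exact: finquo_open quoQ _.
exact: morph_one fM.
Qed.

Lemma small_act a s x : small_factor a -> act s (x : X a) = s.
Proof.
move=> sa; have fx : f (iota a x) = 1 by apply: sa; exists x.
by rewrite /factor_act fx act1.
Qed.

Lemma small_rep a s : small_factor a -> r a s = s.
Proof. by move=> sa; rewrite -[RHS](orbit_rep_shift KS a s) small_act. Qed.

Definition factor_range := fun a => hom_range (iota a).
Definition conj_index := {a : A & set_type (double_reps a)}.
Definition conj_part (au : conj_index) : subgroup H := conj_cap_family factor_range H au.

Definition double_rep a s : set_type (double_reps a) :=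
  exist _ (t (r a s)) (mem_set (ex_intro2 _ _ (r a s) (orbit_rep_idem a s) erefl)).

Lemma double_rep_val a (u : set_type (double_reps a)) :
  exists2 s, r a s = s & \val u = t s.
Proof. by have /set_mem [s rs <-] := valP u; exists s. Qed.

(** All double coset representatives, for all factors, lie in one finite set of
    coset representatives. Intersecting the conjugates of a neighbourhood by
    these reduces the claim to the convergence of the factors. *)
Lemma conj_part_convergent : convergent (fun au => incl_hom (conj_part au)).
Proof.
move=> _ [[U oU <-] U1].
pose V := \bigcap_(s in [set: S]) [set g | U (t s * g * (t s)^-1)].
have oV : open_nbhs 1 V.
  split; last by move=> s _; rewrite /= mulg1 mulgV.
  rewrite openE => g gV; apply: filterS (filter_forall (F := nbhs g) (f := fun s =>
    [set g | U (t s * g * (t s)^-1)]) _ _); first by move=> v gv s _; exact: gv.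
  move=> s; apply: open_nbhs_nbhs; split; last exact: gV.
  by apply: open_comp oU => x _; apply: continuousJ => y; exact: cvg_id.
have finV := free_product_convergent freeG oV.
have := finite_image2 (fun a s => existT _ a (double_rep a s) : conj_index)
   finV (@finite_finset S setT).
apply: sub_finite_set => -[a u] /= nU.
have [s rs us] := double_rep_val u.
exists a.
  move=> /= aV; apply: nU => _ [z _ <-] /=.
  have [_ [x _ <-] zE] := @subgroup_valP _ (conj_part (existT _ a u)) z.
  have : U (t s * iota a x * (t s)^-1) by apply: aV => //; exists x.
  by rewrite -us -zE.
exists s => //; congr existT; apply/val_inj.
by rewrite /= us rs.
Qed.

(** The Schreier generator comparing two representatives of the coset [s]: the
    one obtained inside the orbit of the factor [a] and the one given by the
    tree. *)
Definition cross a s : G := t (r a s) * iota a (sh a s) * (t s)^-1.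

Lemma cross_mem a s : (H : set G) (cross a s).
Proof.
apply/HE; rewrite /cross !fM !actM act_transversal (morph_inv fM).
by rewrite actE orbit_rep_shift -[X in to X _](act_transversal s) actK.
Qed.

Definition cross_elt a s : set_type H := subgroup_elt (cross_mem a s).

(** The pairs whose Schreier generator is not trivially 1: the others are base
    points and edges of the tree. They index a basis of the free factor. *)
Definition nontree : set (A * S) :=
  [set p | r p.1 p.2 <> p.2 /\ tree_parent KS p.2 <> Some p.1].

Lemma nontree_rep a s : r a s = s -> ~ nontree (a, s).
Proof. by move=> rs []. Qed.

Lemma cross_tree a s : ~ nontree (a, s) -> cross a s = 1.
Proof.
move=> nt; rewrite /cross.
have [rs|nrs] := pselect (r a s = s).
  by rewrite (orbit_shift_rep rs) rs gmulf1 mulg1 mulgV.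
have ps : tree_parent KS s = Some a by apply: contrapT => nps; apply: nt.
by rewrite -(coset_rep_parent ps) mulgV.
Qed.

(** Almost all factors are contained in the kernel of the action, and then every
    point is its own base point. *)
Lemma finite_nontree : finite_set nontree.
Proof.
have := finite_setX finite_large_factor (@finite_finset S setT).
apply: sub_finite_set.
by move=> [a s] [nrs _]; split=> // sa; apply: nrs; exact: small_rep.
Qed.

(** Moves an element of the factor sending [s] to s.x back to the base point of
    their common orbit, where it becomes an element of the stabilizer. *)
Definition shifted a s (x : X a) : X a := sh a s * x * (sh a (act s x))^-1.

Lemma shifted_act a s (x : X a) : act (r a s) (shifted s x) = r a s.
Proof.
rewrite /shifted !(factor_actM _ _ fM) orbit_rep_shift.
rewrite -[X in factor_act _ _ _ X _^-1](orbit_rep_shift KS a (act s x)).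
by rewrite (factor_actK _ _ fM) orbit_rep_act.
Qed.

Lemma shiftedM a s (x y : X a) :
  shifted s (x * y) = shifted s x * shifted (act s x) y.
Proof. by rewrite /shifted (factor_actM _ _ fM) !mulgA mulgVK. Qed.

(** * Generation and extension of homomorphisms *)

Hypothesis H_open : open (H : set G).

Lemma conj_mem a s (x : X a) : act (r a s) x = r a s ->
  (H : set G) (t (r a s) * iota a x * (t (r a s))^-1).
Proof.
move=> rx; apply/HE; rewrite !fM !actM act_transversal (morph_inv fM) actE rx.
by rewrite -[X in to X _](act_transversal (r a s)) actK.
Qed.

Lemma conj_elt_part a s (x : X a) (rx : act (r a s) x = r a s) :
  (conj_part (existT _ a (double_rep a s)) : set (set_type H)) (subgroup_elt (conj_mem rx)).
Proof. by exists (iota a x) => //; exists x. Qed.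

Lemma open_act_fiber a s p : open [set x : X a | act s x = p].
Proof.
apply: (@open_fiber_comp _ _ _ (fun x => f (iota a x)) (to s)) => q.
apply: (@open_comp _ _ (iota a) (f @^-1` [set q])); last exact: finquo_open quoQ q.
by move=> x _; exact: cts_fun.
Qed.

(** The element t(s) g t(s.g)^-1 always lies in [H]. The [g] for which it lies in
    [L] for every [s] form a closed subgroup of [G], and it contains the factors because on them the expression is a
    product of two Schreier generators and a conjugate of an element of a
    stabilizer. For [g] in [H] and [s] the root the expression is [g]. *)
Lemma subgroup_generated (L : subgroup (set_type H)) :
  closed (L : set (set_type H)) ->
  (forall au, (conj_part au : set (set_type H)) `<=` (L : set (set_type H))) ->
  (forall a s, nontree (a, s) -> (L : set (set_type H)) (cross_elt a s)) ->
  forall h, (L : set (set_type H)) h.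
Proof.
move=> clL partL crossL h.
have proG := free_product_pro freeG.
pose L' := image_subgroup L.
have clL' : closed (L' : set G).
  exact: (image_subgroup_closed extC proG (open_subgroup_closed H_open) clL).
have crossL' a s : (L' : set G) (cross a s).
  have [nt|nt] := pselect (nontree (a, s)); first by exists (cross_elt a s) => //; exact: crossL.
  by rewrite (cross_tree nt); exact: subgroup1.
pose M_ := [set g | forall s, (L' : set G) (t s * g * (t (to s (f g)))^-1)].
have M1 : M_ 1 by move=> s; rewrite (morph_one fM) act1 mulg1 mulgV; exact: subgroup1.
have MM x y : M_ x -> M_ y -> M_ (x * y).
  move=> Mx My s; have := subgroupM (Mx s) (My (to s (f x))).
  by rewrite fM actM !mulgA mulgVK.
have MV x : M_ x -> M_ x^-1.
  move=> Mx s; have := subgroupV (Mx (to s (f x^-1))).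
  by rewrite (morph_inv fM) actKV !invgM invgK !mulgA.
have Mall : forall g, M_ g.
  apply: (free_product_generated extC freeG (M := Subgroup M1 MM MV)) => [|a x s].
    rewrite (_ : subgroup_set _ = \bigcap_(s in [set: S])
      (fun g => t s * g * (t (to s (f g)))^-1) @^-1` (L' : set G)); last first.
      by apply/seteqP; split=> g gM s; [move=> _; exact: gM | exact: gM s I].
    apply: closed_bigI => s _; apply: closed_comp clL' => g _.
    apply: (continuous_piecewise (f := fun g => to s (f g))
      (g := fun p g => t s * g * (t p)^-1)) => [|p].
      exact: (@open_fiber_comp _ _ _ f (to s) (finquo_open quoQ)).
    by apply: continuousJ => y; exact: cvg_id.
  have [k Lk kE] : exists2 k, (L : set (set_type H)) k &
      subgroup_val k = t (r a s) * iota a (shifted s x) * (t (r a s))^-1.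
    by exists (subgroup_elt (conj_mem (shifted_act s x))) => //; exact: partL (conj_elt_part _).
  have := subgroupM (subgroupM (subgroupV (crossL' a s)) (ex_intro2 _ _ k Lk kE))
    (crossL' a (act s x)).
  congr ((L' : set G) _); rewrite actE /cross /shifted orbit_rep_act.
  by rewrite !invgM !invgK !gmulfM gmulfV !mulgA !mulgVK.
have := Mall (subgroup_val h) s0.
have /HE -> := subgroup_valP h; rewrite coset_rep1 mul1g invg1 mulg1.
exact: image_subgroupP.
Qed.

Section Extension.
Variables (K : topGroupType) (lam : forall au, contHom (set_type (conj_part au)) K).
Hypotheses (proK : pro C K) (lam_conv : convergent lam).
Variable y : A -> S -> K.
Hypothesis y_nontree : forall a s, ~ nontree (a, s) -> y a s = 1.

(** The element u x u^-1 of [H], extended by 1 to all of the factor so that it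
    can be composed with [shifted] without carrying proofs; the extension is
    continuous because stabilizers are open. *)
Definition local_elt a s (x : X a) : set_type (conj_part (existT _ a (double_rep a s))) :=
  if pselect (act (r a s) x = r a s) is left rx then subgroup_elt (conj_elt_part rx) else 1.

Lemma local_eltE a s (x : X a) : act (r a s) x = r a s ->
  subgroup_val (subgroup_val (local_elt s x)) = t (r a s) * iota a x * (t (r a s))^-1.
Proof. by rewrite /local_elt; case: pselect. Qed.

Definition local_hom a s (x : X a) : K := lam (existT _ a (double_rep a s)) (local_elt s x).

(** Removes the dependence of types on the representative of the double
    coset. *)
Lemma local_homE a s (x : X a) (u : set_type (double_reps a))
    (z : set_type (conj_part (existT _ a u))) :
  \val u = t (r a s) -> act (r a s) x = r a s ->
  subgroup_val (subgroup_val z) = t (r a s) * iota a x * (t (r a s))^-1 ->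
  lam (existT _ a u) z = local_hom s x.
Proof.
move=> us rx; have uE : u = double_rep a s by apply/val_inj.
rewrite uE in z *; rewrite /local_hom => zE; congr (lam _ _).
by apply/subgroup_val_inj/subgroup_val_inj; rewrite zE local_eltE.
Qed.

Lemma local_hom_rep a s s' (x : X a) : r a s = r a s' -> act (r a s) x = r a s ->
  local_hom s x = local_hom s' x.
Proof.
by move=> ss' rx; apply: local_homE; rewrite -?ss' //; exact: local_eltE.
Qed.

Lemma local_homM a s (x z : X a) : act (r a s) x = r a s -> act (r a s) z = r a s ->
  local_hom s (x * z) = local_hom s x * local_hom s z.
Proof.
move=> rx rz; have rxz : act (r a s) (x * z) = r a s.
  by rewrite (factor_actM _ _ fM) rx.
rewrite /local_hom -gmulfM; congr (lam _ _).
apply/subgroup_val_inj/subgroup_val_inj.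
by rewrite !subgroup_valM !local_eltE // gmulfM !mulgA mulgVK.
Qed.

Lemma local_hom1 a s : local_hom s (1 : X a) = 1.
Proof.
have r1 : act (r a s) (1 : X a) = r a s by exact: (factor_act1 _ _ fM).
by apply: (mulgI (local_hom s (1 : X a))); rewrite -(local_homM r1 r1) !mulg1.
Qed.

Lemma local_hom_continuous a s : continuous (@local_hom a s).
Proof.
move=> x; apply: (@continuous_comp _ _ _ (@local_elt a s)
  (lam (existT _ a (double_rep a s)))); last exact: cts_fun.
move: x; apply/into_subgroup_continuous/into_subgroup_continuous.
rewrite (_ : (fun x => _) = (fun x : X a => if act (r a s) x == r a s
    then t (r a s) * iota a x * (t (r a s))^-1 else 1)); last first.
  apply/funext => x; case: eqP => rx; first exact: local_eltE.
  by rewrite /local_elt; case: pselect.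
apply: (continuous_piecewise (f := fun x : X a => act (r a s) x)
  (g := fun p x => if p == r a s then t (r a s) * iota a x * (t (r a s))^-1 else 1)).
  by move=> p; exact: open_act_fiber.
move=> p; case: eqP => _; last by move=> z; exact: cst_continuous.
by apply: continuousJ => z; exact: cts_fun.
Qed.

(** The only cocycle compatible with the prescribed data: it is the value of the
    wanted homomorphism at t(s) x t(s.x)^-1, written through the Schreier
    generators and an element of the stabilizer of the base point. *)
Definition factor_cocycle a s (x : X a) : K :=
  (y a s)^-1 * local_hom s (shifted s x) * y a (act s x).

Lemma factor_cocycleM a s (x z : X a) :
  factor_cocycle s (x * z) = factor_cocycle s x * factor_cocycle (act s x) z.
Proof.
rewrite /factor_cocycle shiftedM local_homM; last 2 first.
- exact: shifted_act.
- by rewrite -[X in act X _](orbit_rep_act KS s x) shifted_act orbit_rep_act.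
rewrite (@local_hom_rep a s (act s x) (shifted (act s x) z)).
- by rewrite (factor_actM _ _ fM) !mulgA mulgK.
- by rewrite orbit_rep_act.
by rewrite -[X in act X _](orbit_rep_act KS s x) shifted_act orbit_rep_act.
Qed.

Lemma factor_cocycle_continuous a s : continuous (@factor_cocycle a s).
Proof.
apply: (continuous_piecewise (f := fun x : X a => act s x) (g := fun p x =>
  (y a s)^-1 * local_hom s (sh a s * x * (sh a p)^-1) * y a p)).
  by move=> p; exact: open_act_fiber.
move=> p; apply: continuousJ => x.
apply: (@continuous_comp _ _ _ (fun x => sh a s * x * (sh a p)^-1) (@local_hom a s)).
  by apply: continuousJ => z; exact: cvg_id.
exact: local_hom_continuous.
Qed.

(** For a factor acting trivially every point is a base point with shift 1, and
    the cocycle reduces to the prescribed homomorphisms on the conjugates of the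
    factor. *)
Lemma factor_cocycle_convergent (U : set K) : open_nbhs 1 U ->
  finite_set [set a | ~ forall s x, U (@factor_cocycle a s x)].
Proof.
move=> /lam_conv fin2; have := finite_image (fun au : conj_index => tag au) fin2.
move=> fin2'; have := conj finite_large_factor fin2'; rewrite -finite_setU.
apply: sub_finite_set => a /= nU.
apply: contrapT => /not_orP [/contrapT sa ngood]; apply: nU => s x.
have rs s' : r a s' = s' by exact: small_rep.
have shs s' : sh a s' = 1 by exact: orbit_shift_rep.
have ys s' : y a s' = 1 by apply: y_nontree; exact: nontree_rep.
rewrite /factor_cocycle !ys invg1 mul1g mulg1.
apply: contrapT => nUs; apply: ngood.
exists (existT _ a (double_rep a s)) => // lamU; apply: nUs; apply: lamU.
by exists (local_elt s (shifted s x)).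
Qed.

(** Along an edge from a base point the stabilizer contributes 1, so the cocycle
    is the value prescribed at the Schreier generator. *)
Lemma factor_cocycle_shift a s : factor_cocycle (r a s) (sh a s) = y a s.
Proof.
rewrite /factor_cocycle /shifted orbit_rep_shift (orbit_shift_rep (orbit_rep_idem a s)).
rewrite mul1g mulgV local_hom1 y_nontree; last exact/nontree_rep/orbit_rep_idem.
by rewrite invg1 !mul1g.
Qed.

(** Glue the cocycles of the factors to a cocycle [b] of [G] and restrict
    [b s0] to the stabilizer [H] of the root. Along the tree [b s0] is 1 at every
    coset representative, which makes the values on the given subgroups and on
    the Schreier generators readable. *)
Lemma extension_exists : exists l : contHom (set_type H) K,
  (forall au z, l (subgroup_val z) = lam au z) /\
  (forall a s, l (cross_elt a s) = y a s).
Proof.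
have [b [bc bM bE]] := cocycle_extension extC freeG quoQ proK
  factor_cocycleM factor_cocycle_continuous factor_cocycle_convergent.
have b1 s : b s 1 = 1.
  by apply: (mulgI (b s 1)); rewrite -[X in _ * b X _](act1 to s)
    -(morph_one fM) -bM !mulg1.
pose l (h : set_type H) := b s0 (subgroup_val h).
have lM : {morph l : x z / x * z}.
  by move=> x z; rewrite /l subgroup_valM bM; have /HE -> := subgroup_valP x.
have lc : continuous l.
  move=> h; apply: (@continuous_comp _ _ _ (@subgroup_val G H) (b s0)).
    exact: subgroup_val_continuous.
  exact: bc.
have bt s : b s0 (t s) = 1.
  move: s; apply: (kurosh_ind (k := KS)) => [|s a ps IHs]; first by rewrite coset_rep1.
  rewrite (coset_rep_parent ps) bM IHs mul1g act_transversal bE factor_cocycle_shift.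
  by apply: y_nontree => -[].
have btV s : b s (t s)^-1 = 1.
  by have := bM s0 (t s) (t s)^-1; rewrite mulgV b1 bt mul1g act_transversal.
exists (make_hom lM lc); split=> [[a u] z|a s]; last first.
  rewrite /= /l /= /cross !bM bt mul1g act_transversal bE factor_cocycle_shift.
  by rewrite fM actM act_transversal actE orbit_rep_shift btV mulg1.
have [s rs us] := double_rep_val u.
have [_ [x _ <-] zE] := @subgroup_valP _ (conj_part (existT _ a u)) z.
have sx : act s x = s.
  have /HE := subgroup_valP (subgroup_val z).
  have -> : subgroup_val (subgroup_val z) = t s * iota a x * (t s)^-1.
    by rewrite -us; exact: zE.
  rewrite !fM !actM act_transversal (morph_inv fM) actE => h.
  by rewrite -[RHS](act_transversal s) -[X in to X _]h actKV.
rewrite /= /l.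
have -> : subgroup_val (subgroup_val z) = t s * iota a x * (t s)^-1.
  by rewrite -us; exact: zE.
rewrite !bM bt mul1g fM actM !act_transversal actE sx btV mulg1 bE.
rewrite /factor_cocycle sx (y_nontree (nontree_rep rs)) invg1 mul1g mulg1.
rewrite /shifted sx (orbit_shift_rep rs) mul1g invg1 mulg1; apply: esym.
by apply: local_homE; rewrite rs ?us //; rewrite -us; exact: zE.
Qed.

End Extension.

(** * The decomposition *)

Lemma subgroup_hom_eq (K : topGroupType) (l m : contHom (set_type H) K) :
  hausdorff_space K ->
  (forall au z, l (@subgroup_val _ (conj_part au) z) = m (subgroup_val z)) ->
  (forall a s, nontree (a, s) -> l (cross_elt a s) = m (cross_elt a s)) -> l =1 m.
Proof.
move=> hK part_eq crossE h.
apply: (subgroup_generated (L := equalizer l m)) => //.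
  exact: equalizer_closed.
by move=> au z zau; exact: (part_eq au (subgroup_elt zau)).
Qed.

(** The closed subgroup topologically generated by the Schreier generators, as
    the intersection of the closed subgroups containing them. *)
Definition cross_span_set : set (set_type H) :=
  \bigcap_(M in [set M : subgroup (set_type H) | closed (M : set _) /\
    forall a s, nontree (a, s) -> (M : set _) (cross_elt a s)]) (M : set _).

Fact cross_span1 : cross_span_set 1.
Proof. by move=> M _; exact: subgroup1. Qed.
Fact cross_spanM x y : cross_span_set x -> cross_span_set y -> cross_span_set (x * y).
Proof. by move=> Mx My M hM; apply: subgroupM; [exact: Mx | exact: My]. Qed.
Fact cross_spanV x : cross_span_set x -> cross_span_set x^-1.
Proof. by move=> Mx M hM; apply: subgroupV; exact: Mx. Qed.

Definition cross_span := Subgroup cross_span1 cross_spanM cross_spanV.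

Lemma cross_span_closed : closed (cross_span : set (set_type H)).
Proof. by apply: closed_bigI => M []. Qed.

Lemma cross_span_mem a s : nontree (a, s) -> (cross_span : set _) (cross_elt a s).
Proof. by move=> nt M [_]; exact. Qed.

Lemma subgroup_pro : pro C (set_type H).
Proof.
by apply: (closed_subgroup_pro extC (free_product_pro freeG)); exact: open_subgroup_closed.
Qed.

Lemma cross_span_pro : pro C (set_type cross_span).
Proof. exact: (closed_subgroup_pro extC subgroup_pro cross_span_closed). Qed.

Lemma conj_part_closed au : closed (conj_part au : set (set_type H)).
Proof.
case: au => a u; have proG := free_product_pro freeG.
have clR : closed (range (iota a)).
  apply: compact_closed; first exact: residually_hausdorff (pro_residually proG).
  apply: continuous_compact; first exact/continuous_subspaceT/cts_fun.
  exact: residually_compact (pro_residually (free_product_pro_factor freeG a)).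
rewrite (_ : (conj_part _ : set _) = (fun h : set_type H =>
    (\val u)^-1 * subgroup_val h * \val u) @^-1` range (iota a)); last first.
  apply/seteqP; split=> h /=.
    by move=> [_ [x _ <-] /= ->]; exists x => //; rewrite !mulgA mulVg mul1g mulgVK.
  move=> [x _ xE]; exists (iota a x); first by exists x.
  by rewrite xE !mulgA mulgV mul1g mulgK.
apply: closed_comp clR => h _; apply: continuousJ => z.
exact: subgroup_val_continuous.
Qed.

Lemma cross_span_hom_eq (K : topGroupType) (l m : contHom (set_type cross_span) K) :
  hausdorff_space K ->
  (forall a s (nt : nontree (a, s)), l (subgroup_elt (cross_span_mem nt)) =
    m (subgroup_elt (cross_span_mem nt))) -> l =1 m.
Proof.
move=> hK lm x.
apply: (image_subgroupP (L := equalizer l m)).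
apply: (subgroup_valP x); split=> [|a s nt].
  apply: (image_subgroup_closed extC subgroup_pro cross_span_closed).
  exact: equalizer_closed.
by exists (subgroup_elt (cross_span_mem nt)) => //; exact: lm.
Qed.

Lemma trivial_homM (G1 K : topGroupType) : {morph (fun _ : G1 => 1 : K) : x y / x * y}.
Proof. by move=> x y; rewrite mulg1. Qed.

Lemma trivial_hom_continuous (G1 K : topGroupType) : continuous (fun _ : G1 => 1 : K).
Proof. by move=> x; exact: cst_continuous. Qed.

Lemma restrictM (M : subgroup (set_type H)) (K : topGroupType)
  (l : contHom (set_type H) K) : {morph (fun x : set_type M => l (subgroup_val x)) : x y / x * y}.
Proof. by move=> x y; rewrite subgroup_valM gmulfM. Qed.

Lemma restrict_continuous (M : subgroup (set_type H)) (K : topGroupType)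
  (l : contHom (set_type H) K) : continuous (fun x : set_type M => l (subgroup_val x)).
Proof.
move=> x; apply: (@continuous_comp _ _ _ (@subgroup_val _ M) l); last exact: cts_fun.
exact: subgroup_val_continuous.
Qed.

(** A map on the basis extends to [H] by the trivial homomorphisms on the other
    factors; restricting to the span gives the universal property without a
    separate construction of a free group. *)
Lemma cross_span_free : free_pro_finite_rank C (set_type cross_span).
Proof.
split; first exact: cross_span_pro.
have [F [b [b_inj b_nt nt_b]]] : exists (F : finType) (b : F -> A * S),
    [/\ injective b, forall i, nontree (b i) & forall p, nontree p -> exists i, b i = p].
  exact/finite_set_enum/finite_nontree.
have bnt i : nontree ((b i).1, (b i).2) by rewrite -surjective_pairing.
pose e i := subgroup_elt (cross_span_mem (bnt i)).
exists F, e => K phi proK.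
have hK := residually_hausdorff (pro_residually proK).
pose y a s := if pselect (exists i, b i = (a, s)) is left h
  then phi (projT1 (cid h)) else 1.
have y_b i : y (b i).1 (b i).2 = phi i.
  rewrite /y; case: pselect => [h|[]]; last by exists i; rewrite -surjective_pairing.
  by congr phi; apply: b_inj; rewrite (projT2 (cid h)) -surjective_pairing.
have y_nt a s : ~ nontree (a, s) -> y a s = 1.
  by move=> nt; rewrite /y; case: pselect => // -[i bi]; case: nt; rewrite -bi.
pose triv (au : conj_index) : contHom (set_type (conj_part au)) K :=
  make_hom (@trivial_homM _ _) (@trivial_hom_continuous _ _).
have triv_conv : convergent triv.
  move=> U [_ U1]; rewrite (_ : [set _ | _] = set0); first exact: finite_set0.
  by apply/seteqP; split=> // au /= nU; case: nU => _ [z _ <-].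
have [l [_ lE]] := extension_exists proK triv_conv y_nt.
exists (make_hom (@restrictM cross_span K l) (@restrict_continuous cross_span K l)).
  by move=> i /=; rewrite -y_b -lE.
move=> m mE; apply: cross_span_hom_eq => // a s nt /=.
have [i bi] := nt_b _ nt.
have -> : subgroup_elt (cross_span_mem nt) = e i.
  apply/subgroup_val_inj; change (cross_elt a s = cross_elt (b i).1 (b i).2).
  by rewrite bi.
have /= -> := mE i.
by rewrite -y_b -lE.
Qed.

(** A homomorphism on the free factor enters [extension_exists] through its
    values at the Schreier generators, which determine it. *)
Lemma decomposition_free : free_product C (fun i : option conj_index =>
  incl_hom (decomposition factor_range (H := H) cross_span i)).
Proof.
split.
- exact: subgroup_pro.
- case=> [au|]; last exact: cross_span_pro.
  have proF := closed_subgroup_pro extC subgroup_pro (@conj_part_closed au).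
  exact proF.
- move=> U oU; have := conj (finite_image Some (conj_part_convergent oU))
    (finite_set1 (None : option conj_index)).
  rewrite -finite_setU; apply: sub_finite_set => -[au|] /= nU; last by right.
  by left; exists au.
move=> K lam_ proK conv.
have hK := residually_hausdorff (pro_residually proK).
pose lam (au : conj_index) : contHom (set_type (conj_part au)) K := lam_ (Some au).
have lam_conv : convergent lam.
  move=> U oU; have := @finite_preimage _ _ _ (@Some conj_index) _ (conv U oU).
  by apply => x z _ _ [].
pose y a s : K := if pselect (nontree (a, s)) is left nt
  then lam_ None (subgroup_elt (cross_span_mem nt)) else 1.
have y_nt a s : ~ nontree (a, s) -> y a s = 1 by rewrite /y; case: pselect.
have y_in a s (nt : nontree (a, s)) : y a s = lam_ None (subgroup_elt (cross_span_mem nt)).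
  by rewrite /y; case: pselect => // nt'; rewrite (Prop_irrelevance nt nt').
have [l [l_fam l_cross]] := extension_exists proK lam_conv y_nt.
exists l => [[au|] z|m mE].
- exact: l_fam.
- have := @cross_span_hom_eq K (make_hom (@restrictM cross_span K l)
    (@restrict_continuous cross_span K l)) (lam_ None) hK.
  by apply => a s nt; rewrite -y_in -l_cross.
apply: subgroup_hom_eq => // [au z|a s nt].
  rewrite l_fam; exact: (mE (Some au) z).
rewrite l_cross (y_in _ _ nt).
exact: (mE None (subgroup_elt (cross_span_mem nt))).
Qed.

End OpenSubgroup.

Theorem theorem4p4p1 (C : group_class) (C_ext : extension_closed_variety C)
    (A : Type) (Gamma_ : A -> topGroupType) (Gamma : topGroupType)
    (iota : forall a, contHom (Gamma_ a) Gamma)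
    (Gamma_free : free_product C iota)
    (H : subgroup Gamma) (H_open : open (H : set Gamma)) :
  exists D : A -> set Gamma,
  [/\ forall a, double_coset_reps H (hom_range (iota a)) (D a),
      convergent (fun au : {a : A & set_type (D a)} =>
        incl_hom (conj_cap_family (fun a => hom_range (iota a)) H au))
    & exists2 Phi : subgroup H,
        free_pro_finite_rank C Phi
        & free_product C (fun i : option {a : A & set_type (D a)} =>
            incl_hom (decomposition (fun a => hom_range (iota a)) Phi i))].
Proof.
have [Q [f [S [to [s0 [quoQ HE to_trans]]]]]] :=
  coset_action C_ext (free_product_pro Gamma_free) H_open.
have [KS] := kurosh_system_exists (finquoM quoQ)
  (free_product_reach C_ext Gamma_free quoQ to_trans).
exists (double_reps KS); split.
- exact: (double_repsP quoQ HE).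
- exact: (conj_part_convergent Gamma_free).
exists (cross_span quoQ HE KS).
  exact: (cross_span_free C_ext Gamma_free).
exact: (decomposition_free C_ext Gamma_free).
Qed.
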